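(* For all $p\in[1,2]$, $\delta\in(0,1)$ and $0<\varepsilon<(\log(1/\delta))^{1/2-1/p}$, any (possibly randomized, possibly adaptive) algorithm that, for every input real square matrix ${\bm{A}}$, succeeds with probability at least $1-\delta$ in outputting an estimate $t$ with $|t-\operatorname{tr}({\bm{A}})|\le \varepsilon\|{\bm{A}}\|_p$ requires $$\Omega\!\left(\left(\frac{\sqrt{\log(1/\delta)}}{\varepsilon}\right)^p\right)$$ matrix-vector multiplication queries.
   Context: For a real matrix ${\bm{X}}$ with singular values $\sigma_i$, $\|{\bm{X}}\|_p=(\sum_i\sigma_i^p)^{1/p}$ is its Schatten-$p$ norm. The algorithm accesses ${\bm{A}}$ only through real-valued query vectors $x$ (chosen possibly adaptively based on previous answers), receiving ${\bm{A}}x$ for each (real RAM model: queries and answers are exact real vectors).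
   Formalization: The Ω-constant is uniform over δ in (0,δ0] for each fixed δ0<1 (a constant uniform as δ→1 is impossible), and for p=1 it is also assumed that ε<1 (otherwise t=0 works with no queries); the bound is on the query count at some matrix size n. *)

(* Defs.v *)
From HB Require Import structures.
From mathcomp Require Import all_boot all_order all_algebra.
From mathcomp Require polyrcf.
From mathcomp Require Import all_classical all_reals all_analysis.
Set Implicit Arguments.
Unset Strict Implicit.
Unset Printing Implicit Defensive.
Import Order.TTheory GRing.Theory Num.Theory.
Local Open Scope classical_set_scope.
Local Open Scope ring_scope.

(* The square roots of the eigenvalues of A^T A, repeated according to their
   multiplicity in its characteristic polynomial ([rootsR] lists the distinct
   roots). *)
Definition singular_values (R : realType) (m n : nat) (A : 'M[R]_(m, n)) :
    seq R :=
  let chi := char_poly (A^T *m A) in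
  flatten [seq nseq (mup l chi) (Num.sqrt l) | l <- polyrcf.rootsR chi].

Definition schatten_norm (R : realType) (p : R) (m n : nat)
    (A : 'M[R]_(m, n)) : R :=
  (\sum_(s <- singular_values A) s `^ p) `^ p^-1.

(* R^n as tuples rather than column vectors: [n.-tuple T] carries the product
   sigma-algebra in the library. *)
Notation vec R n := (n.-tuple (measurableTypeR R)).

Definition mulmxv (R : realType) (n : nat) (A : 'M[R]_n) (x : vec R n) :
    vec R n :=
  [tuple (A *m \col_j tnth x j) i 0 | i < n].

(* A randomized adaptive algorithm making k matrix-vector queries to an n x n
   matrix. Its random seed is a point of T; the j-th query (counted from 0) is
   a function of the seed and of the j previous answers, most recent first, and
   the output is a function of the seed and of all k answers. An algorithm
   stopping early is one whose remaining queries are the zero vector.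
   Measurability is joint in the seed and the answers: measurability in the
   seed alone, for each fixed matrix, would under the continuum hypothesis
   admit algorithms that recover every matrix almost surely from one query. *)
Record query_algorithm (R : realType) (d : measure_display)
    (T : measurableType d) (n k : nat) := QueryAlgorithm {
  query : forall j : nat, T * j.-tuple (vec R n) -> vec R n ;
  output : T * k.-tuple (vec R n) -> measurableTypeR R ;
  measurable_query : forall j : nat, measurable_fun setT (@query j) ;
  measurable_output : measurable_fun setT output }.

Section run.
Context {R : realType} {d : measure_display} {T : measurableType d}.
Context {n k : nat} (alg : query_algorithm R T n k) (A : 'M[R]_n) (w : T).

Fixpoint answers (j : nat) : j.-tuple (vec R n) :=
  if j is i.+1 then
    let h := answers i in [tuple of mulmxv A (query alg (w, h)) :: h]
  else [tuple].

Definition estimate : R := output alg (w, answers k).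

End run.

Definition trace_estimator (R : realType) (d : measure_display)
    (T : measurableType d) (P : probability T R) (p delta eps : R)
    (n k : nat) (alg : query_algorithm R T n k) : Prop :=
  forall A : 'M[R]_n,
    ((1 - delta)%:E <=
     P [set w : T | (`|estimate alg A w - \tr A| <= eps * schatten_norm p A)%R])%E.

(* Main.v *)
Require Import Defs.
From HB Require Import structures.
From mathcomp Require Import all_boot all_order all_algebra.
From mathcomp Require Import complex.
From mathcomp Require polyrcf.
From mathcomp Require Import all_classical all_reals all_analysis.
From mathcomp Require Import measurable_realfun.
From mathcomp Require Import ring lra.
Import Order.TTheory GRing.Theory Num.Theory.
Import numFieldNormedType.Exports.
Local Open Scope ring_scope.
Set Implicit Arguments.
Unset Strict Implicit.
Unset Printing Implicit Defensive.

(** The hard input is an n x n matrix A with independent standard Gaussian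
    entries, n of order (sqrt (log (1/delta)) / eps)^p.  For a fixed seed, the
    Gaussian law is invariant under right multiplication by an orthogonal
    matrix, so the first query may be rotated to a multiple of the first basis
    vector; its answer is then the first column, and conditionally on it the
    other columns are still independent Gaussian.  Hence after k queries the
    trace is a known quantity plus a centred normal variable of variance n - k,
    and no estimate is within v * sqrt (n - k) of it with probability more than
    1 - exp (- v^2 - 3), nor more than v.  On the other hand
    ||A||_p <= n^(1/p - 1/2) ||A||_F, and ||A||_F <= 3 n up to probability
    exp (- n^2).  Averaging the guarantee of the algorithm over A (Tonelli, with
    the seed integrated last) contradicts k <= n / 2.  When the bound to be
    proved is below 1, it only has to be shown that some query is made: an
    algorithm without queries would have to output arbitrarily large numbers
    with probability at least 1 - delta on the inputs s * I. *)

(** * Schatten norm and Frobenius norm *)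

Section gram.
Variable R : rcfType.
Local Notation C := (R[i]%C).
Local Notation toC := (real_complex R).

(** A left eigenvector [v] over [R[i]] gives z |v|^2 = |v A^T|^2. In the order of [R[i]], [0 <= z]
    also says that [z] is real. *)
Lemma gram_eigenvalue_ge0 (m n : nat) (A : 'M[R]_(m, n)) (z : C) :
  root (map_poly toC (char_poly (A^T *m A))) z -> 0 <= z.
Proof.
rewrite map_char_poly -eigenvalue_root_char => /eigenvalueP[v vg v0].
have norm2 (k : nat) (u : 'rV[C]_k) :
    (u *m map_mx Num.conj u^T) 0 0 = \sum_j `|u 0 j| ^+ 2.
  by rewrite mxE; apply: eq_bigr => j _; rewrite !mxE normCK.
have H : z * \sum_j `|v 0 j| ^+ 2 = \sum_j `|(v *m map_mx toC A^T) 0 j| ^+ 2.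
  have AE : map_mx Num.conj (map_mx toC A^T)^T = map_mx toC A.
    apply/matrixP => i j; rewrite !mxE.
    by apply: conj_Creal; apply/complex_realP; eexists.
  rewrite -!norm2 trmx_mul map_mxM AE.
  by rewrite mulmxA -(mulmxA v) -map_mxM vg -scalemxAl [in RHS]mxE.
have vpos : 0 < \sum_j `|v 0 j| ^+ 2.
  rewrite lt_neqAle sumr_ge0 ?andbT => [|i _]; last by rewrite exprn_ge0.
  apply: contra v0 => /eqP/esym/psumr_eq0P h; apply/eqP/rowP => j.
  have /eqP := h (fun i _ => exprn_ge0 _ (normr_ge0 _)) j isT.
  by rewrite mxE sqrf_eq0 normr_eq0 => /eqP.
by rewrite -(pmulr_lge0 z vpos) H; apply: sumr_ge0 => i _; rewrite exprn_ge0.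
Qed.

(** The polynomial splits over the closed field [R[i]]; its roots are nonnegative, hence real, so
    the factorization descends to [R]. *)
Lemma gram_char_poly_split (m n : nat) (A : 'M[R]_(m, n)) :
  exists2 s : seq R, char_poly (A^T *m A) = \prod_(l <- s) ('X - l%:P) &
    all (fun l => 0 <= l) s.
Proof.
have [r] := closed_field_poly_normal (map_poly toC (char_poly (A^T *m A))).
rewrite lead_coef_map (monicP (char_poly_monic _)) rmorph1 scale1r => E.
have rge0 z : z \in r -> 0 <= z.
  by move=> zr; apply: (@gram_eigenvalue_ge0 _ _ A); rewrite E root_prod_XsubC.
have rE : r = [seq toC (complex.Re z) | z <- r].
  rewrite -[LHS]map_id; apply/eq_in_map => z /rge0 zge0.
  by have /ger0_real/complex_realP[k ->] := zge0.
exists [seq complex.Re z | z <- r].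
  apply: (map_poly_inj toC); rewrite E rmorph_prod/= rE -!map_comp !big_map.
  by apply: eq_bigr => z _; rewrite rmorphB/= map_polyX map_polyC/=.
apply/allP => _ /mapP[z /rge0 zr ->].
by move: zr; rewrite lecE/= => /andP[].
Qed.

End gram.

Section schatten.
Variable R : realType.

(** Both sides are square roots of lists in which each x occurs [mup x chi] times, because [rootsR]
    lists each root once. *)
Lemma singular_values_split (m n : nat) (A : 'M[R]_(m, n)) (s : seq R) :
  char_poly (A^T *m A) = \prod_(l <- s) ('X - l%:P) ->
  perm_eq (singular_values A) [seq Num.sqrt l | l <- s].
Proof.
move=> E; rewrite /singular_values E; set chi := \prod_(_ <- _) _.
have chi0 : chi != 0 by rewrite /chi -E monic_neq0 ?char_poly_monic.
have -> : [seq nseq (mup l chi) (Num.sqrt l) | l <- polyrcf.rootsR chi] =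
    [seq [seq Num.sqrt x | x <- u] |
      u <- [seq nseq (mup l chi) l | l <- polyrcf.rootsR chi]].
  by rewrite -map_comp; apply: eq_map => l /=; rewrite map_nseq.
rewrite -map_flatten; apply: perm_map; apply/allP => x _ /=; apply/eqP.
rewrite -(mu_prod_XsubC x s) -/chi count_flatten -map_comp.
have -> : [seq (count_mem x \o (fun l => nseq (mup l chi) l)) i
             | i <- polyrcf.rootsR chi] =
          [seq (if i == x then mup x chi else 0%N) | i <- polyrcf.rootsR chi].
  apply: eq_map => l /=; rewrite count_nseq/=.
  by case: eqP => [->|]; rewrite ?mul1n ?mul0n.
rewrite sumnE big_map -big_mkcond/=.
have uR : uniq (polyrcf.rootsR chi).
  by apply: (sorted_uniq lt_trans ltxx); exact: polyrcf.sorted_roots.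
have [xr|xr] := boolP (x \in polyrcf.rootsR chi).
  rewrite -big_filter filter_pred1_uniq//.
  by rewrite big_cons big_nil addn0.
rewrite big1_seq; last by move=> i /andP[/eqP->]; rewrite (negbTE xr).
rewrite mupNroot//; apply: contra xr => rx.
have := polyrcf.roots_on_rootsR chi0 x.
by rewrite rx andbT in_itv/= => <-.
Qed.


(** Young's inequality with conjugate exponents 1/q and 1/(1 - q); q = 1 is treated apart. *)
Lemma weighted_AGM (x y q : R) : 0 <= x -> 0 <= y -> 0 < q <= 1 ->
  x `^ q * y `^ (1 - q) <= q * x + (1 - q) * y.
Proof.
move=> x0 y0 /andP[q0]; rewrite le_eqVlt => /predU1P[->|q1].
  by rewrite subrr mul0r addr0 powRr0 mulr1 powRr1 // mul1r.
have q'0 : 0 < 1 - q by rewrite subr_gt0.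
have := @conjugate_powR R (x `^ q) (y `^ (1 - q)) q^-1 (1 - q)^-1
  (powR_ge0 _ _) (powR_ge0 _ _).
rewrite !invr_gt0 !invrK -!powRrM !divff ?gt_eqF// !powRr1// => /(_ q0 q'0).
by rewrite addrC subrK (mulrC x) (mulrC y); exact.
Qed.

(** Jensen's inequality for the concave power q: compare each x with the mean S / N by
    [weighted_AGM], then sum. *)
Lemma powR_mean_le (s : seq R) (q : R) : 0 < q <= 1 ->
  all (fun x => 0 <= x) s ->
  \sum_(x <- s) x `^ q <= (size s)%:R `^ (1 - q) * (\sum_(x <- s) x) `^ q.
Proof.
move=> /andP[q0 q1] /allP s_ge0; set N : R := (size s)%:R.
set S := \sum_(x <- s) x.
have S0 : 0 <= S by rewrite /S big_seq; apply: sumr_ge0 => x /s_ge0.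
have [SE|Sneq0] := eqVneq S 0.
  rewrite big_seq big1 ?mulr_ge0 ?powR_ge0// => x xs.
  have /eqP : x == 0.
    rewrite eq_le s_ge0 ?andbT// -SE /S (big_rem x)//= lerDl.
    by rewrite big_seq; apply: sumr_ge0 => y /mem_rem/s_ge0.
  by move=> ->; rewrite powR0// gt_eqF.
have Sgt0 : 0 < S by rewrite lt_neqAle eq_sym Sneq0.
have N0 : 0 < N.
  rewrite ltr0n lt0n size_eq0; apply: contraNneq Sneq0 => sE.
  by rewrite /S sE big_nil.
have M0 : 0 < S / N by rewrite divr_gt0.
rewrite -(ler_pM2r (powR_gt0 (1 - q) M0)) mulr_suml.
have -> : N `^ (1 - q) * S `^ q * (S / N) `^ (1 - q) = S.
  rewrite mulrAC -powRM ?ltW// mulrC mulrCA divff ?gt_eqF// mulr1 -powRD.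
    by rewrite addrC subrK powRr1.
  by rewrite (gt_eqF Sgt0) implybT.
apply: (@le_trans _ _ (\sum_(x <- s) (q * x + (1 - q) * (S / N)))).
  rewrite big_seq [leRHS]big_seq; apply: ler_sum => x xs.
  by apply: weighted_AGM; [exact: s_ge0|exact: ltW|rewrite q0].
rewrite big_split/= -mulr_sumr -/S big_const_seq count_predT iter_addr_0.
rewrite -mulr_natr -/N -mulrA divfK ?gt_eqF//.
by rewrite -mulrDl addrC subrK mul1r.
Qed.

(** The p-th powers of the singular values are the powers p/2 of the eigenvalues of A^T A, whose sum
    is the trace; [powR_mean_le] applies with q = p/2. *)
Lemma schatten_le_frobenius (n : nat) (A : 'M[R]_n) (p : R) : 1 <= p <= 2 ->
  schatten_norm p A <= n%:R `^ (p^-1 - 2^-1) * Num.sqrt (\tr (A^T *m A)).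
Proof.
move=> /andP[p1 p2]; have p0 : 0 < p by apply: lt_le_trans p1.
have [s E s_ge0] := gram_char_poly_split A.
have sn : size s = n.
  by have := size_char_poly (A^T *m A); rewrite E size_prod_XsubC => -[].
have strace : \sum_(l <- s) l = \tr (A^T *m A).
  case: n => [|n] in A E sn *.
    by rewrite (size0nil sn) big_nil /mxtrace big_ord0.
  apply: oppr_inj; rewrite -char_poly_trace// E -{1}sn coefPn_prod_XsubC//.
  by rewrite sn.
have tr_ge0 : 0 <= \tr (A^T *m A).
  by rewrite -strace big_seq; apply: sumr_ge0 => x /(allP s_ge0).
rewrite /schatten_norm (perm_big _ (singular_values_split E)) big_map.
have -> : \sum_(l <- s) Num.sqrt l `^ p = \sum_(l <- s) l `^ (p / 2).
  rewrite big_seq [RHS]big_seq; apply: eq_bigr => l ls.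
  by rewrite -powR12_sqrt ?(allP s_ge0)// -powRrM mulrC.
have q01 : 0 < p / 2 <= 1 by rewrite divr_gt0//= ler_pdivrMr// mul1r.
have := powR_mean_le q01 s_ge0; rewrite sn strace.
move=> /(ge0_ler_powR (_ : 0 <= p^-1)); rewrite invr_ge0 (ltW p0) => /(_ isT).
rewrite !nnegrE => /(_ _ _)/le_trans; apply.
- by apply: sumr_ge0 => l _; exact: powR_ge0.
- by rewrite mulr_ge0 ?powR_ge0.
rewrite powRM ?powR_ge0// -!powRrM mulrAC divff ?gt_eqF// mul1r powR12_sqrt//.
by rewrite mulrBl mul1r mulrAC divff ?gt_eqF// mul1r.
Qed.

End schatten.

(** * Gaussian measures and rotations *)

Section power_measure.
Context d (V : measurableType d) (R : realType).
Local Open Scope classical_set_scope.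

Definition tcons (m : nat) (x : V * m.-tuple V) : m.+1.-tuple V :=
  [tuple of x.1 :: x.2].

Lemma measurable_tcons m : measurable_fun setT (@tcons m).
Proof.
by apply: measurable_cons; [exact: measurable_fst|exact: measurable_snd].
Qed.

HB.instance Definition _ m :=
  isMeasurableFun.Build _ _ _ _ (@tcons m) (@measurable_tcons m).

Variable mu : probability V R.

(** Built as an image under [tcons], so that Tonelli splits off the first coordinate. *)
Fixpoint power_measure (m : nat) : probability (m.-tuple V) R :=
  if m is i.+1 then distribution (mu \x power_measure i)%E (@tcons i)
  else dirac [tuple].

Local Open Scope ereal_scope.

Lemma power_measure0E (f : 0%N.-tuple V -> \bar R) :
  measurable_fun setT f -> \int[power_measure 0%N]_t f t = f [tuple].
Proof. by move=> mf; rewrite /= integral_dirac// diracT mul1e. Qed.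

Lemma power_measureSE m (f : m.+1.-tuple V -> \bar R) :
  measurable_fun setT f -> (forall t, 0 <= f t) ->
  \int[power_measure m.+1]_t f t =
  \int[mu]_x \int[power_measure m]_t f (tcons (x, t)).
Proof.
move=> mf f0; rewrite [LHS]ge0_integral_distribution//.
have mfc : measurable_fun setT (f \o @tcons m).
  by apply: measurableT_comp => //; exact: measurable_tcons.
by rewrite (fubini_tonelli1 (f \o @tcons m))// => z; exact: f0.
Qed.

End power_measure.

(** * Normal density; Lebesgue measure under translations, shears and rotations *)

Section density.
Variable R : realType.
Local Open Scope ereal_scope.
Local Notation leb := (@lebesgue_measure R).
Local Notation RR := (measurableTypeR R).

(** The Radon-Nikodym derivative and [normal_pdf] have the same integral over every measurable set,
    so they agree almost everywhere. *)
Lemma ge0_integral_normal (m s : R) (f : RR -> \bar R) :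
  measurable_fun setT f -> (forall x, 0 <= f x) ->
  \int[normal_prob m s]_x f x = \int[leb]_x (f x * (normal_pdf m s x)%:E).
Proof.
move=> mf f0; have dom := normal_prob_dominates m s.
rewrite -(Radon_Nikodym_SigmaFinite.change_of_variables dom)//.
have mpdf : measurable_fun setT (fun x : RR => (normal_pdf m s x)%:E).
  by apply/measurable_EFinP; exact: measurable_normal_pdf.
apply: ae_eq_integral => //.
- apply: emeasurable_funM => //; apply: (measurable_int leb).
  exact: Radon_Nikodym_SigmaFinite.f_integrable.
- exact: emeasurable_funM.
- apply: ae_eqe_mul2l; apply: integral_ae_eq => //=.
  + exact: Radon_Nikodym_SigmaFinite.f_integrable.
  + by move=> E _ mE; rewrite -Radon_Nikodym_SigmaFinite.f_integral.
Qed.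

Lemma ge0_integral_translation (a : R) (f : RR -> \bar R) :
  measurable_fun setT f -> (forall x, 0 <= f x) ->
  \int[leb]_x f (x + a)%R = \int[leb]_x f x.
Proof.
move=> mf f0.
have mshift : measurable_fun setT ((fun x => x + a)%R : RR -> RR).
  exact: measurable_funD.
rewrite -[LHS](ge0_integral_pushforward mshift leb measurableT mf)//.
pose g : {mfun RR >-> RR} := HB.pack (fun x : RR => x + a)%R
  (isMeasurableFun.Build _ _ _ _ _ mshift).
apply: (@eq_measure_integral _ _ _ _ _ (pushforward leb g)) => A mA _.
apply/esym/lebesgue_measure_unique => //= _ [[u v]] _ <-.
rewrite /pushforward.
have -> : (g @^-1` `]u, v] = `](u - a)%R, (v - a)%R])%classic.
  by apply/seteqP; split => x /=; rewrite !in_itv/= ltrBlDr lerBrDr.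
rewrite !lebesgue_measure_itv/= !lte_fin ltrD2r.
by case: ifP => // _; rewrite -!EFinB; congr EFin; ring.
Qed.

(** As an iterated integral, a shear along the second axis is a translation of the inner variable;
    one along the first axis becomes so after Tonelli. *)
Definition lebesgue2 (f : RR * RR -> \bar R) :=
  \int[leb]_x \int[leb]_y f (x, y).

Lemma shear2 (a : R) (f : RR * RR -> \bar R) :
  measurable_fun setT f -> (forall x, 0 <= f x) ->
  lebesgue2 (fun z => f (z.1, z.2 + a * z.1)%R) = lebesgue2 f.
Proof.
move=> mf f0; apply: eq_integral => x _ /=.
apply: (ge0_integral_translation (a * x)%R (f := fun y => f (x, y))) => //.
exact: measurableT_comp.
Qed.

Lemma measurable_linear2 (a b c d : R) : measurable_fun setT
  (fun z : RR * RR => (a * z.1 + b * z.2, c * z.1 + d * z.2)%R : RR * RR).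
Proof.
by apply: measurable_fun_pair; apply: measurable_funD => //;
  exact: measurable_funM.
Qed.

Lemma measurable_comp_linear2 (a b c d : R) (f : RR * RR -> \bar R) :
  measurable_fun setT f -> measurable_fun setT
    (fun z : RR * RR => f (a * z.1 + b * z.2, c * z.1 + d * z.2)%R).
Proof.
by move=> mf; exact: (measurableT_comp mf (measurable_linear2 a b c d)).
Qed.

Lemma shear1 (a : R) (f : RR * RR -> \bar R) :
  measurable_fun setT f -> (forall x, 0 <= f x) ->
  lebesgue2 (fun z => f (z.1 + a * z.2, z.2)%R) = lebesgue2 f.
Proof.
move=> mf f0; rewrite /lebesgue2.
pose g (z : RR * RR) := f (z.1 + a * z.2, z.2)%R.
have mg : measurable_fun setT g.
  rewrite (_ : g = fun z => f (1 * z.1 + a * z.2, 0 * z.1 + 1 * z.2)%R).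
    exact: measurable_comp_linear2.
  by apply/funext => z; rewrite !mul1r mul0r add0r.
have g0 z : 0 <= g z by exact: f0.
apply: etrans (fubini_tonelli g mg g0) _.
apply: etrans _ (esym (fubini_tonelli f mf f0)).
apply: eq_integral => y _ /=.
apply: (ge0_integral_translation (a * y)%R (f := fun x => f (x, y))) => //.
exact: measurableT_comp.
Qed.

(* A plane rotation is a product of three shears. *)
Lemma lebesgue2_rotation (c s : R) (f : RR * RR -> \bar R) :
  (c ^+ 2 + s ^+ 2 = 1)%R -> s != 0%R ->
  measurable_fun setT f -> (forall x, 0 <= f x) ->
  lebesgue2 (fun z => f (c * z.1 + s * z.2, - s * z.1 + c * z.2)%R) =
  lebesgue2 f.
Proof.
(* [a] is the tangent of half the angle; the shears have parameters [a], [- s], [a]. The division is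
   the reason for [s != 0]. *)
move=> cs s0 mf f0; pose a := ((1 - c) / s)%R.
have cE : (c = 1 - a * s)%R by rewrite /a divfK// subKr.
have sE : (s = a * (2 - a * s))%R.
  by rewrite /a divfK//; apply: (mulfI s0); rewrite mulrA mulrCA divff//; lra.
pose f1 (z : RR * RR) := f (z.1 + a * z.2, z.2)%R.
pose f2 (z : RR * RR) := f1 (z.1, z.2 + - s * z.1)%R.
have m1 : measurable_fun setT f1.
  rewrite (_ : f1 = fun z => f (1 * z.1 + a * z.2, 0 * z.1 + 1 * z.2)%R).
    exact: measurable_comp_linear2.
  by apply/funext => z; rewrite !mul1r mul0r add0r.
have m2 : measurable_fun setT f2.
  rewrite (_ : f2 = fun z => f1 (1 * z.1 + 0 * z.2, - s * z.1 + 1 * z.2)%R).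
    exact: measurable_comp_linear2.
  by apply/funext => z; rewrite !mul1r mul0r addr0 addrC.
apply: etrans _ (shear1 a mf f0).
apply: etrans _ (shear2 (- s) m1 (fun z => f0 _)).
apply: etrans _ (shear1 a m2 (fun z => f0 _)).
apply: eq_integral => x _; apply: eq_integral => y _ /=.
rewrite /f2 /f1 /=; congr (f (_, _)).
- have -> : (s * y = a * (2 - a * s) * y)%R by rewrite -sE.
  by rewrite cE; ring.
- by rewrite cE; ring.
Qed.

End density.

(** * Rotation invariance of the plane Gaussian measure *)

Section gaussian2.
Variable R : realType.
Local Open Scope ereal_scope.
Local Notation leb := (@lebesgue_measure R).
Local Notation RR := (measurableTypeR R).
Local Notation gam := (normal_prob 0 1 : probability RR R).

Definition gauss2 (f : RR * RR -> \bar R) :=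
  \int[gam]_x \int[gam]_y f (x, y).

Lemma gauss2E (f : RR * RR -> \bar R) :
  measurable_fun setT f -> (forall x, 0 <= f x) ->
  gauss2 f = lebesgue2 (fun z =>
    f z * (normal_pdf 0 1 z.1 * normal_pdf 0 1 z.2)%:E).
Proof.
move=> mf f0; rewrite /gauss2 ge0_integral_normal; first last.
- by move=> x; apply: integral_ge0.
- exact: (measurable_fun_fubini_tonelli_F f).
apply: eq_integral => x _ /=.
have mfx : measurable_fun setT (fun y => f (x, y)) by exact: measurableT_comp.
rewrite ge0_integral_normal// -ge0_integralZr//.
- by apply: eq_integral => y _; rewrite -muleA -EFinM mulrC.
- apply: emeasurable_funM => //.
  by apply/measurable_EFinP; exact: measurable_normal_pdf.
- by move=> y _; rewrite mule_ge0// lee_fin normal_pdf_ge0.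
- by rewrite lee_fin normal_pdf_ge0.
Qed.

Lemma normal_pdf2E (x y : R) : (normal_pdf 0 1 x * normal_pdf 0 1 y =
  normal_peak 1 ^+ 2 * expR (- (x ^+ 2 + y ^+ 2) / 2))%R.
Proof.
rewrite normal_pdfE ?oner_eq0//= /normal_fun mulrACA -expRD -expr2.
by congr (_ * expR _)%R; rewrite !subr0 expr1n; field.
Qed.

(** The product density depends only on x^2 + y^2, which the rotation preserves. *)
Lemma gauss2_rotation (c s : R) (f : RR * RR -> \bar R) :
  (c ^+ 2 + s ^+ 2 = 1)%R -> s != 0%R ->
  measurable_fun setT f -> (forall x, 0 <= f x) ->
  gauss2 (fun z => f (c * z.1 + s * z.2, - s * z.1 + c * z.2)%R) = gauss2 f.
Proof.
move=> cs s0 mf f0.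
have mrot := measurable_comp_linear2 c s (- s)%R c mf.
apply: etrans (gauss2E mrot (fun z => f0 _)) _.
apply: etrans _ (esym (gauss2E mf f0)).
apply: etrans _ (lebesgue2_rotation cs s0 _ _).
- apply: eq_integral => x _; apply: eq_integral => y _ /=; congr (_ * _%:E).
  rewrite !normal_pdf2E; congr (_ * expR (- _ / 2))%R.
  transitivity ((c ^+ 2 + s ^+ 2) * (x ^+ 2 + y ^+ 2))%R; last by ring.
  by rewrite cs mul1r.
- apply: emeasurable_funM => //; apply/measurable_EFinP.
  by apply: measurable_funM; apply: measurableT_comp => //;
    exact: measurable_normal_pdf.
- by move=> z; rewrite mule_ge0// lee_fin mulr_ge0 ?normal_pdf_ge0.
Qed.

End gaussian2.

(** * Gaussian vectors: rotation of a pair, law of a linear form *)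

Section gaussian_vector.
Variable R : realType.
Local Open Scope ereal_scope.
Local Notation RR := (measurableTypeR R).
Local Notation gam := (normal_prob 0 1 : probability RR R).

Definition gaussv (n : nat) : probability (vec R n) R := power_measure gam n.

Lemma integral_probability_cst d (T : measurableType d) (P : probability T R)
  (c : \bar R) : \int[P]_x c = c.
Proof. by rewrite integral_cst//= probability_setT mule1. Qed.

Definition lin2 (n : nat) (c s : R) (a b : vec R n) : vec R n :=
  [tuple (c * tnth a i + s * tnth b i)%R | i < n].

Lemma lin2_cons n (c s x y : R) (a b : vec R n) :
  lin2 c s (tcons (x : RR, a)) (tcons (y : RR, b)) =
  tcons ((c * x + s * y)%R : RR, lin2 c s a b).
Proof.
apply: eq_from_tnth => i; rewrite tnth_mktuple.
have [j ->|->] := unliftP ord0 i; first by rewrite !tnthS tnth_mktuple.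
by rewrite !tnth0.
Qed.

Lemma measurable_lin2 n (c s : R) d (T : measurableType d) (f g : T -> vec R n) :
  measurable_fun setT f -> measurable_fun setT g ->
  measurable_fun setT (fun x => lin2 c s (f x) (g x)).
Proof.
move=> mf mg; apply/measurable_fun_tnthP => i.
rewrite (_ : _ \o _ = fun x => (c * tnth (f x) i + s * tnth (g x) i)%R).
  have mt := @measurable_tnth _ RR n i.
  apply: measurable_funD; apply: measurable_funM => //.
    exact: (measurableT_comp mt mf).
  exact: (measurableT_comp mt mg).
by apply/funext => x /=; rewrite tnth_mktuple.
Qed.

Lemma measurable_tcons_comp d (T : measurableType d) d' (V : measurableType d')
    n (f : T -> V) (g : T -> n.-tuple V) :
  measurable_fun setT f -> measurable_fun setT g ->
  measurable_fun setT (fun x => tcons (f x, g x)).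
Proof. exact: measurable_cons. Qed.

Lemma measurable_integral_snd d1 d2 (T1 : measurableType d1)
    (T2 : measurableType d2) (mu : probability T2 R) (f : T1 * T2 -> \bar R) :
  measurable_fun setT f -> (forall z, 0 <= f z) ->
  measurable_fun setT (fun x => \int[mu]_y f (x, y)).
Proof. by move=> mf f0; exact: (measurable_fun_fubini_tonelli_F f). Qed.

(** Tonelli regroups two vectors into the pair of their heads and the pair of their tails, the form
    needed for induction on the length. *)
Lemma gaussv2_cons n (G : vec R n.+1 * vec R n.+1 -> \bar R) :
  measurable_fun setT G -> (forall z, 0 <= G z) ->
  \int[gaussv n.+1]_a \int[gaussv n.+1]_b G (a, b) =
  gauss2 (fun z => \int[gaussv n]_a \int[gaussv n]_b
                     G (tcons (z.1, a), tcons (z.2, b))).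
Proof.
move=> mG G0.
apply: etrans (@power_measureSE _ _ _ gam n
  (fun a => \int[gaussv n.+1]_b G (a, b)) _ _) _.
- exact: measurable_integral_snd.
- by move=> t; exact: integral_ge0.
apply: eq_integral => x _.
pose K (p : vec R n * RR) := \int[gaussv n]_u G (tcons (x, p.1), tcons (p.2, u)).
have mK : measurable_fun setT K.
  apply: (measurable_integral_snd (gaussv n)
    (f := fun q : (vec R n * RR) * vec R n =>
    G (tcons (x, q.1.1), tcons (q.1.2, q.2)))) => //.
  have mpair : measurable_fun setT (fun q : (vec R n * RR) * vec R n =>
      (tcons (x, q.1.1), tcons (q.1.2, q.2))).
    apply: measurable_fun_pair; apply: measurable_tcons_comp => //;
      exact: measurableT_comp.
  exact: (measurableT_comp mG mpair).
have K0 p : 0 <= K p by exact: integral_ge0.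
apply: etrans _ (@fubini_tonelli _ _ _ _ R (gaussv n) gam K mK K0).
apply: eq_integral => t _.
apply: (@power_measureSE _ _ _ gam n (fun b => G (tcons (x, t), b))) => //.
exact: measurableT_comp.
Qed.

(** The heads form a plane Gaussian pair, rotated by [gauss2_rotation]; the tails are rotated by
    induction. *)
Lemma gaussv_rotation n (c s : R) (F : vec R n * vec R n -> \bar R) :
  (c ^+ 2 + s ^+ 2 = 1)%R -> s != 0%R ->
  measurable_fun setT F -> (forall z, 0 <= F z) ->
  \int[gaussv n]_a \int[gaussv n]_b F (lin2 c s a b, lin2 (- s) c a b) =
  \int[gaussv n]_a \int[gaussv n]_b F (a, b).
Proof.
move=> cs s0; elim: n F => [|n IH] F mF F0.
  by apply: eq_integral => a _; apply: eq_integral => b _;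
    congr (F (_, _)); apply: eq_from_tnth => -[].
have mrot : measurable_fun setT (fun z : vec R n.+1 * vec R n.+1 =>
    (lin2 c s z.1 z.2, lin2 (- s) c z.1 z.2)).
  by apply: measurable_fun_pair; exact: measurable_lin2.
have mFrot := measurableT_comp mF mrot.
apply: etrans (gaussv2_cons mFrot (fun z => F0 _)) _.
apply: etrans _ (esym (gaussv2_cons mF F0)).
pose H (z : RR * RR) := \int[gaussv n]_a \int[gaussv n]_b
   F (tcons (z.1, a), tcons (z.2, b)).
have mH : measurable_fun setT H.
  pose K (q : (RR * RR) * vec R n) := \int[gaussv n]_b
    F (tcons (q.1.1, q.2), tcons (q.1.2, b)).
  have mK : measurable_fun setT K.
    apply: (measurable_integral_snd (gaussv n)
      (f := fun q : ((RR * RR) * vec R n) * vec R n =>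
        F (tcons (q.1.1.1, q.1.2), tcons (q.1.1.2, q.2)))) => //.
    have mpair : measurable_fun setT (fun q : ((RR * RR) * vec R n) * vec R n =>
        (tcons (q.1.1.1, q.1.2), tcons (q.1.1.2, q.2))).
      apply: measurable_fun_pair; apply: measurable_tcons_comp => //.
      - by apply: measurableT_comp => //; exact: measurableT_comp.
      - exact: measurableT_comp.
      - by apply: measurableT_comp => //; exact: measurableT_comp.
    exact: (measurableT_comp mF mpair).
  apply: (measurable_integral_snd (gaussv n) (f := K)) => // q.
  exact: integral_ge0.
have H0 z : 0 <= H z by apply: integral_ge0 => a _; exact: integral_ge0.
apply: etrans _ (gauss2_rotation cs s0 mH H0).
apply: eq_integral => x _; apply: eq_integral => y _ /=.
pose F' (z : vec R n * vec R n) :=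
  F (tcons ((c * x + s * y)%R : RR, z.1), tcons ((- s * x + c * y)%R : RR, z.2)).
have mF' : measurable_fun setT F'.
  have mpair : measurable_fun setT (fun z : vec R n * vec R n =>
      (tcons ((c * x + s * y)%R : RR, z.1),
       tcons ((- s * x + c * y)%R : RR, z.2))).
    by apply: measurable_fun_pair; exact: measurable_tcons_comp.
  exact: (measurableT_comp mF mpair).
apply: etrans _ (IH F' mF' (fun z => F0 _)).
by apply: eq_integral => a _; apply: eq_integral => b _; rewrite !lin2_cons.
Qed.

(* [rho] may be negative. *)
Lemma gauss2_linear (al be : R) : exists2 rho : R,
  (rho ^+ 2 = al ^+ 2 + be ^+ 2)%R &
  forall h : RR -> \bar R, measurable_fun setT h -> (forall x, 0 <= h x) ->
    gauss2 (fun z => h (al * z.1 + be * z.2)%R) = \int[gam]_x h (rho * x)%R.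
Proof.
have const (f : RR -> \bar R) : gauss2 (fun z => f z.1) = \int[gam]_x f x.
  by apply: eq_integral => x _; exact: (integral_probability_cst gam (f x)).
(* Here no rotation with [s != 0] is available, and [al] itself, of either sign, is the witness. *)
have [be0|be0] := eqVneq be 0%R.
  exists al; first by rewrite be0 expr0n/= addr0.
  move=> h mh h0; rewrite -const; apply: eq_integral => x _.
  by apply: eq_integral => y _ /=; rewrite be0 mul0r addr0.
pose r := Num.sqrt (al ^+ 2 + be ^+ 2).
have r2 : (r ^+ 2 = al ^+ 2 + be ^+ 2)%R.
  by rewrite sqr_sqrtr// addr_ge0 ?sqr_ge0.
have r0 : r != 0%R.
  rewrite sqrtr_eq0 -ltNge ltr_wpDl ?sqr_ge0//.
  by rewrite lt_neqAle sqr_ge0 eq_sym sqrf_eq0 be0.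
exists r => // h mh h0.
have cs : ((al / r) ^+ 2 + (be / r) ^+ 2 = 1)%R.
  by rewrite !exprMn -mulrDl -r2 -exprMn divff// expr1n.
have s0 : (be / r != 0)%R by rewrite mulf_neq0// invr_eq0.
have mhr : measurable_fun setT (fun z : RR * RR => h (r * z.1)%R).
  by apply: (measurableT_comp mh); exact: measurable_funM.
rewrite -const; apply: etrans _ (gauss2_rotation cs s0 mhr (fun z => h0 _)).
apply: eq_integral => x _; apply: eq_integral => y _ /=; congr h.
by field.
Qed.

Definition dot (n : nat) (w : 'I_n -> R) (a : vec R n) : R :=
  (\sum_i w i * tnth a i)%R.

Lemma measurable_dot n (w : 'I_n -> R) : measurable_fun setT (dot w : _ -> RR).
Proof.
apply: measurable_sum => i; apply: measurable_funM => //.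
exact: measurable_tnth.
Qed.

(** By induction the tail of the sum acts as [rho'] times one normal variable, which [gauss2_linear]
    merges with the first term. *)
Lemma gaussv_linear n (w : 'I_n -> R) : exists2 rho : R,
  (rho ^+ 2 = \sum_i w i ^+ 2)%R &
  forall h : RR -> \bar R, measurable_fun setT h -> (forall x, 0 <= h x) ->
    \int[gaussv n]_a h (dot w a) = \int[gam]_x h (rho * x)%R.
Proof.
elim: n w => [|n IH] w.
  exists 0%R; first by rewrite big_ord0 expr0n.
  move=> h mh h0; rewrite power_measure0E; last first.
    exact: (measurableT_comp mh (measurable_dot w)).
  under eq_integral do rewrite mul0r.
  by rewrite (integral_probability_cst gam) /dot big_ord0.
have [rho' rho'2 Hrho'] := IH (fun i => w (lift ord0 i)).
have [rho rho2 Hrho] := gauss2_linear (w ord0) rho'.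
exists rho; first by rewrite rho2 rho'2 big_ord_recl.
move=> h mh h0; rewrite -Hrho// power_measureSE//; last first.
  exact: (measurableT_comp mh (measurable_dot w)).
apply: eq_integral => x _ /=.
rewrite -(Hrho' (fun y => h (w ord0 * x + y)%R))//.
  apply: eq_integral => t _; rewrite /dot big_ord_recl tnth0.
  by congr (h (_ + _)%R); apply: eq_bigr => i _; rewrite tnthS.
by apply: (measurableT_comp mh); exact: measurable_funD.
Qed.

End gaussian_vector.

(** * Givens rotations *)

Section givens.
Variable R : realType.
Implicit Types (m n : nat) (c s : R).

(** Rotation in the plane of the first two coordinates; right multiplication acts on the first two
    columns as [lin2] does on vectors. *)
Definition givens m c s : 'M[R]_(1 + (1 + m)) :=
  block_mx c%:M (row_mx (- s)%:M 0) (col_mx s%:M 0) (block_mx c%:M 0 0 1%:M).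

Lemma mul_row_givens m n c s (a b : 'cV[R]_n) (A : 'M[R]_(n, m)) :
  row_mx a (row_mx b A) *m givens m c s =
  row_mx (c *: a + s *: b) (row_mx (- s *: a + c *: b) A).
Proof.
rewrite /givens mul_row_block mul_row_col mulmx0 addr0.
rewrite mul_row_block mul_mx_row !mulmx0 mulmx1 add0r addr0 add_row_mx add0r.
by rewrite !mul_mx_scalar.
Qed.

Lemma mul_givens_col m n c s (a b : 'rV[R]_n) (A : 'M[R]_(m, n)) :
  givens m c s *m col_mx a (col_mx b A) =
  col_mx (c *: a - s *: b) (col_mx (s *: a + c *: b) A).
Proof.
rewrite /givens mul_block_col mul_row_col mul0mx addr0.
rewrite mul_block_col mul_col_mx !mul0mx mul1mx add0r addr0 add_col_mx add0r.
by rewrite !mul_scalar_mx scaleNr.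
Qed.

Lemma tr_givens m c s : (givens m c s)^T = givens m c (- s).
Proof.
rewrite /givens tr_block_mx tr_row_mx tr_col_mx tr_block_mx !trmx0.
by rewrite !tr_scalar_mx opprK.
Qed.

Lemma givens_orthogonal m c s : c ^+ 2 + s ^+ 2 = 1 ->
  (givens m c s)^T *m givens m c s = 1%:M.
Proof.
move=> cs; rewrite tr_givens [X in X *m _]/givens block_mxEh.
have -> : col_mx (row_mx (- - s)%:M 0) (block_mx c%:M 0 0 1%:M) =
   row_mx (col_mx s%:M (col_mx c%:M 0)) (col_mx 0 (col_mx 0 1%:M))
   :> 'M[R]_(1 + (1 + m), 1 + m).
  by rewrite opprK -block_mxEh [RHS]block_mxEv -block_mxEh.
rewrite mul_row_givens !scale_col_mx !add_col_mx !scale_scalar_mx.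
rewrite !scaler0 !addr0 -!raddfD/= -[1%:M in RHS]/(scalar_mx (n := 1 + (1 + m)) 1).
rewrite !scalar_mx_block !block_mxEh.
have -> : c * c + s * s = 1 by rewrite -!expr2.
have -> : c * - s + s * c = 0 by ring.
have -> : - s * c + c * s = 0 by ring.
have -> : - s * - s + c * c = 1 by rewrite mulrNN -!expr2 addrC.
rewrite !raddf0 col_mx0; congr row_mx.
by rewrite -[LHS]block_mxEh [LHS]block_mxEv row_mx0.
Qed.

(** The angle is that of (x, y). The condition on [y] yields the [s != 0] required for
    invariance. *)
Lemma givens_solve (x y : R) : y != 0 -> exists c s r : R,
  [/\ c ^+ 2 + s ^+ 2 = 1, s != 0, c * x + s * y = r & - s * x + c * y = 0].
Proof.
move=> y0; pose r := Num.sqrt (x ^+ 2 + y ^+ 2).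
have r2 : r ^+ 2 = x ^+ 2 + y ^+ 2 by rewrite sqr_sqrtr// addr_ge0 ?sqr_ge0.
have r0 : r != 0.
  rewrite sqrtr_eq0 -ltNge ltr_wpDl ?sqr_ge0//.
  by rewrite lt_neqAle sqr_ge0 eq_sym sqrf_eq0 y0.
exists (x / r), (y / r); eexists; split; [|by rewrite mulf_neq0// invr_eq0|by []|].
  by rewrite !exprMn -mulrDl -r2 -exprMn divff// expr1n.
by ring.
Qed.

End givens.

(** * Gaussian matrices and right multiplication by rotations *)

Section gaussian_matrix.
Variables (R : realType) (n : nat).
Local Open Scope ereal_scope.
Local Notation RR := (measurableTypeR R).
Local Notation gam := (normal_prob 0 1 : probability RR R).
Implicit Types m : nat.

Definition gaussm m : probability (m.-tuple (vec R n)) R :=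
  power_measure (gaussv R n) m.

(** The tuple lists columns: right multiplication then mixes independent Gaussian vectors, and the
    first column is the head. *)
Definition mx_of m (t : m.-tuple (vec R n)) : 'M[R]_(n, m) :=
  \matrix_(i, j) tnth (tnth t j) i.

Definition col_of (a : vec R n) : 'cV[R]_n := \col_i tnth a i.

(* Measurability on matrices is measurability in the entries. *)
Definition mx_measurable m (F : 'M[R]_(n, m) -> \bar R) :=
  measurable_fun setT (fun t => F (mx_of t)).

Definition Emx m (F : 'M[R]_(n, m) -> \bar R) := \int[gaussm m]_t F (mx_of t).

Lemma mx_measurable_comp m d (T : measurableType d) (F : 'M[R]_(n, m) -> \bar R)
    (G : T -> 'M[R]_(n, m)) :
  mx_measurable F -> (forall i j, measurable_fun setT (fun w => G w i j : RR)) ->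
  measurable_fun setT (fun w => F (G w)).
Proof.
move=> mF mG.
pose t w : m.-tuple (vec R n) := [tuple [tuple G w i j | i < n] | j < m].
rewrite (_ : (fun _ => _) = (fun t => F (mx_of t)) \o t); last first.
  by apply/funext => w /=; congr F; apply/matrixP => i j;
    rewrite mxE !tnth_mktuple.
apply: measurableT_comp => //; apply/measurable_fun_tnthP => j.
apply/measurable_fun_tnthP => i.
rewrite (_ : _ \o _ = fun w => G w i j)//.
by apply/funext => w /=; rewrite !tnth_mktuple.
Qed.

Lemma measurable_mx_of m i j :
  measurable_fun setT (fun t : m.-tuple (vec R n) => mx_of t i j : RR).
Proof.
rewrite (_ : (fun _ => _) = (@tnth n RR ^~ i) \o (@tnth m (vec R n) ^~ j)).
  by apply: measurableT_comp; exact: measurable_tnth.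
by apply/funext => t /=; rewrite mxE.
Qed.

Lemma measurable_mx_mulr m m' (Q : 'M[R]_(m, m')) i j :
  measurable_fun setT
    (fun t : m.-tuple (vec R n) => (mx_of t *m Q)%R i j : RR).
Proof.
rewrite (_ : (fun _ => _) =
    fun t => (\sum_k mx_of t i k * Q k j)%R); last first.
  by apply/funext => t; rewrite mxE.
apply: measurable_sum => k; apply: measurable_funM => //.
exact: measurable_mx_of.
Qed.

Lemma mx_of_tcons m (a : vec R n) (t : m.-tuple (vec R n)) :
  mx_of (tcons (a, t)) = row_mx (col_of a) (mx_of t) :> 'M[R]_(n, 1 + m).
Proof.
apply/matrixP => i j; rewrite !mxE.
case: splitP => k jk.
  have -> : j = ord0 by apply: val_inj => /=; rewrite jk [k]ord1.
  by rewrite tnth0 mxE.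
have -> : j = lift ord0 k by apply: val_inj.
by rewrite tnthS mxE.
Qed.

Lemma measurable_row_mx m i j : measurable_fun setT
  (fun z : vec R n * m.-tuple (vec R n) =>
     (row_mx (col_of z.1) (mx_of z.2) : 'M[R]_(n, 1 + m)) i j : RR).
Proof.
rewrite (_ : (fun _ => _) = (fun t => mx_of t i j : RR) \o @tcons _ _ m).
  by apply: measurableT_comp; [exact: measurable_mx_of|exact: measurable_tcons].
by apply/funext => -[a t] /=; rewrite mx_of_tcons.
Qed.

Lemma EmxS m (F : 'M[R]_(n, 1 + m) -> \bar R) :
  mx_measurable F -> (forall A, 0 <= F A) ->
  Emx F = \int[gaussv R n]_a Emx (fun A => F (row_mx (col_of a) A)).
Proof.
move=> mF F0; apply: etrans (power_measureSE _ mF (fun t => F0 _)) _.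
by apply: eq_integral => a _; apply: eq_integral => t _; rewrite mx_of_tcons.
Qed.

Lemma mx_measurable_row_mx m (F : 'M[R]_(n, 1 + m) -> \bar R) (a : vec R n) :
  mx_measurable F -> mx_measurable (fun A => F (row_mx (col_of a) A)).
Proof.
move=> mF; apply: (mx_measurable_comp mF) => i j.
have mpair : measurable_fun setT (fun t : m.-tuple (vec R n) => (a, t)).
  exact: measurable_fun_pair.
exact: (measurableT_comp (measurable_row_mx i j) mpair).
Qed.

Lemma measurable_Emx_row_mx m (F : 'M[R]_(n, 1 + m) -> \bar R) :
  mx_measurable F -> (forall A, 0 <= F A) ->
  measurable_fun setT (fun a => Emx (fun A => F (row_mx (col_of a) A))).
Proof.
move=> mF F0; apply: (measurable_integral_snd (gaussm m)
  (f := fun z => F (row_mx (col_of z.1) (mx_of z.2)))) => //.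
by apply: (mx_measurable_comp mF) => i j; exact: measurable_row_mx.
Qed.

Lemma mx_measurable_mulr m m' (Q : 'M[R]_(m, m')) (F : 'M[R]_(n, m') -> \bar R) :
  mx_measurable F -> mx_measurable (fun A => F (A *m Q)%R).
Proof.
by move=> mF; apply: (mx_measurable_comp mF) => i j; exact: measurable_mx_mulr.
Qed.

(** A property carried along the construction of a rotation in [exists_rotation], instead of a
    theorem about all orthogonal matrices. *)
Definition invariant_mulr m (Q : 'M[R]_m) :=
  forall F : 'M[R]_(n, m) -> \bar R, mx_measurable F -> (forall A, 0 <= F A) ->
  Emx (fun A => F (A *m Q)%R) = Emx F.

Lemma invariant_mulrM m (P Q : 'M[R]_m) :
  invariant_mulr P -> invariant_mulr Q -> invariant_mulr (P *m Q)%R.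
Proof.
move=> iP iQ F mF F0; rewrite -[RHS]iQ// -[RHS]iP//; last first.
  exact: mx_measurable_mulr.
by rewrite /Emx; under eq_integral do rewrite mulmxA.
Qed.

Lemma invariant_mulr1 m : invariant_mulr (1%:M : 'M[R]_m).
Proof. by move=> F mF F0; rewrite /Emx; under eq_integral do rewrite mulmx1. Qed.

Lemma invariant_block m (Q : 'M[R]_m) : invariant_mulr Q ->
  invariant_mulr (block_mx 1%:M 0 0 Q : 'M[R]_(1 + m)).
Proof.
move=> iQ F mF F0.
apply: etrans (EmxS (mx_measurable_mulr _ mF) (fun A => F0 _)) _.
apply: etrans _ (esym (EmxS mF F0)); apply: eq_integral => a _.
rewrite -[RHS]iQ//; last exact: mx_measurable_row_mx.
apply: eq_integral => t _; congr F.
by rewrite mul_row_block !mulmx0 mulmx1 add0r addr0.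
Qed.

Lemma col_of_lin2 (c s : R) (a b : vec R n) :
  col_of (lin2 c s a b) = (c *: col_of a + s *: col_of b)%R.
Proof. by apply/matrixP => i j; rewrite !mxE tnth_mktuple. Qed.

(** Only the first two columns move; with the others integrated inside, [gaussv_rotation] applies to
    that pair. *)
Lemma invariant_givens m (c s : R) :
  (c ^+ 2 + s ^+ 2 = 1)%R -> s != 0%R -> invariant_mulr (givens m c s).
Proof.
move=> cs s0.
have E2 (G : 'M[R]_(n, 1 + (1 + m)) -> \bar R) :
    mx_measurable G -> (forall A, 0 <= G A) ->
    Emx G = \int[gaussv R n]_a \int[gaussv R n]_b
       Emx (fun A => G (row_mx (col_of a) (row_mx (col_of b) A))).
  move=> mG G0; apply: etrans (EmxS mG G0) _; apply: eq_integral => a _.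
  exact: (EmxS (mx_measurable_row_mx a mG) (fun A => G0 _)).
move=> F mF F0.
apply: etrans (E2 _ (mx_measurable_mulr _ mF) (fun A => F0 _)) _.
apply: etrans _ (esym (E2 _ mF F0)).
pose H (z : vec R n * vec R n) :=
  Emx (fun A => F (row_mx (col_of z.1) (row_mx (col_of z.2) A))).
have mH : measurable_fun setT H.
  apply: (measurable_integral_snd (gaussm m) (f := fun q =>
    F (row_mx (col_of q.1.1) (row_mx (col_of q.1.2) (mx_of q.2))))) => //.
  apply: (mx_measurable_comp mF) => i j.
  have -> : (fun q : vec R n * vec R n * m.-tuple (vec R n) =>
     (row_mx (col_of q.1.1) (row_mx (col_of q.1.2) (mx_of q.2))
       : 'M[R]_(n, 1 + (1 + m))) i j : RR) =
     (fun t => mx_of t i j : RR) \o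
     (fun q => tcons (q.1.1, tcons (q.1.2, q.2))).
    by apply/funext => q /=; rewrite !mx_of_tcons.
  apply: measurableT_comp; first exact: measurable_mx_of.
  apply: measurable_tcons_comp; first exact: measurableT_comp.
  by apply: measurable_tcons_comp => //; exact: measurableT_comp.
have H0 z : 0 <= H z by exact: integral_ge0.
apply: etrans _ (gaussv_rotation cs s0 mH H0).
apply: eq_integral => a _; apply: eq_integral => b _.
by apply: eq_integral => t _; rewrite mul_row_givens !col_of_lin2.
Qed.

(** By induction a block rotation gathers all entries of [x] but the first into the second one; a
    Givens rotation then merges it into the first, unless it is already 0. *)
Lemma exists_rotation m (x : 'cV[R]_(1 + m)) : exists Q : 'M[R]_(1 + m),
  [/\ (Q^T *m Q = 1%:M)%R, exists r : R, (Q^T *m x = col_mx r%:M 0)%R &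
      invariant_mulr Q].
Proof.
elim: m x => [|m IH] x.
  exists 1%:M%R; split; [by rewrite trmx1 mulmx1| |exact: invariant_mulr1].
  exists (x 0%R 0%R); rewrite trmx1 mul1mx [LHS]mx11_scalar.
  apply/matrixP => i j; rewrite !ord1 !mxE.
  by case: splitP => // k _; rewrite !mxE !ord1.
have [Q [QQ [r Qx] iQ]] := IH (dsubmx x).
pose B : 'M[R]_(1 + (1 + m)) := block_mx 1%:M 0 0 Q.
have BB : (B^T *m B = 1%:M)%R.
  rewrite /B tr_block_mx !trmx0 trmx1 mulmx_block !mulmx0 !mul0mx mulmx1.
  by rewrite !addr0 add0r QQ -scalar_mx_block.
have Bx : (B^T *m x = col_mx (usubmx x) (col_mx r%:M 0))%R.
  rewrite -{1}[x]vsubmxK /B tr_block_mx !trmx0 trmx1 mul_block_col.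
  by rewrite !mul0mx mul1mx addr0 add0r Qx.
have iB : invariant_mulr B by exact: invariant_block.
have [r0|r0] := eqVneq r 0%R.
  exists B; split => //; exists (usubmx x 0%R 0%R).
  by rewrite Bx r0 raddf0 col_mx0 -mx11_scalar.
have [c [s [r' [cs s0 e1 e2]]]] := givens_solve (usubmx x 0%R 0%R) r0.
exists (B *m givens m c s)%R; split.
- rewrite trmx_mul mulmxA -(mulmxA _ B^T) BB mulmx1.
  exact: givens_orthogonal.
- exists r'; rewrite trmx_mul -mulmxA Bx tr_givens mul_givens_col.
  rewrite [usubmx x]mx11_scalar !scale_scalar_mx -raddfB -raddfD/=.
  by rewrite (mulNr s r) opprK e1 e2 raddf0 col_mx0.
- exact/invariant_mulrM/invariant_givens.
Qed.

End gaussian_matrix.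

(** * Linear forms and exponential moments of Gaussian matrices *)

Section gaussian_matrix_laws.
Variables (R : realType) (n : nat).
Local Open Scope ereal_scope.
Local Notation RR := (measurableTypeR R).
Local Notation gam := (normal_prob 0 1 : probability RR R).
Implicit Types m : nat.

Lemma trace_row_mx m (u a : 'cV[R]_n) (M A : 'M[R]_(n, m)) :
  (\tr ((row_mx u M)^T *m row_mx a A) = \tr (u^T *m a) + \tr (M^T *m A))%R.
Proof. by rewrite tr_row_mx mul_col_row mxtrace_block. Qed.

Lemma trace_col_of (u : 'cV[R]_n) (a : vec R n) :
  (\tr (u^T *m col_of a) = dot (fun i => u i 0) a)%R.
Proof. by rewrite trace_mx11 mxE; apply: eq_bigr => i _; rewrite !mxE. Qed.

Lemma measurable_trace_mul m (M : 'M[R]_(n, m)) : measurable_fun setT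
  (fun t : m.-tuple (vec R n) => (\tr (M^T *m mx_of t))%R : RR).
Proof.
rewrite (_ : (fun _ => _) =
    fun t => (\sum_j \sum_i M i j * mx_of t i j)%R); last first.
  apply/funext => t; apply: eq_bigr => j _; rewrite mxE.
  by apply: eq_bigr => i _; rewrite !mxE.
apply: measurable_sum => j; apply: measurable_sum => i.
by apply: measurable_funM => //; exact: measurable_mx_of.
Qed.

(** One column at a time: the first contributes [r1], the others [r2], and [gauss2_linear] merges
    the two. *)
Lemma gaussm_linear m (M : 'M[R]_(n, m)) : exists2 rho : R,
  (rho ^+ 2 = \tr (M^T *m M))%R &
  forall h : RR -> \bar R, measurable_fun setT h -> (forall x, 0 <= h x) ->
    Emx (fun A => h (\tr (M^T *m A))%R) = \int[gam]_x h (rho * x)%R.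
Proof.
elim: m M => [|m IH] M.
  exists 0%R; first by rewrite /mxtrace big_ord0 expr0n.
  move=> h mh h0; apply: (@etrans _ _ (h 0%R)).
    apply: etrans (integral_probability_cst (gaussm R n 0) (h 0%R)).
    by apply: eq_integral => t _; rewrite /mxtrace big_ord0.
  apply: etrans (esym (integral_probability_cst gam (h 0%R))) _.
  by apply: eq_integral => x _; rewrite mul0r.
have [r1 r12 H1] := gaussv_linear (fun i => lsubmx (M : 'M[R]_(n, 1 + m)) i 0%R).
have [r2 r22 H2] := IH (rsubmx (M : 'M[R]_(n, 1 + m))).
have [rho rho2 H] := gauss2_linear r1 r2.
exists rho.
  rewrite rho2 r12 r22 -[in RHS](@hsubmxK _ n 1 m M) trace_row_mx.
  congr (_ + _)%R; rewrite trace_mx11 mxE; apply: eq_bigr => i _.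
  by rewrite !mxE expr2.
move=> h mh h0; rewrite -H//.
have mF : mx_measurable (fun A : 'M[R]_(n, 1 + m) => h (\tr (M^T *m A))%R).
  exact: (measurableT_comp mh (measurable_trace_mul M)).
apply: etrans (EmxS mF (fun A => h0 _)) _.
pose g (s : RR) := \int[gam]_y h (s + r2 * y)%R.
have mg : measurable_fun setT g.
  apply: (measurable_integral_snd gam
    (f := fun z : RR * RR => h (z.1 + r2 * z.2)%R)) => //.
  by apply: (measurableT_comp mh); apply: measurable_funD => //;
    exact: measurable_funM.
have g0 s : 0 <= g s by exact: integral_ge0.
apply: etrans _ (H1 g mg g0); apply: eq_integral => a _.
have mh' : measurable_fun setT
    (fun y : RR => h (\tr ((lsubmx (M : 'M[R]_(n, 1 + m)))^T *m col_of a) + y)%R).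
  by apply: (measurableT_comp mh); exact: measurable_funD.
rewrite -trace_col_of; apply: etrans _ (H2 _ mh' (fun y => h0 _)).
apply: eq_integral => t _; congr h.
by rewrite -{1}(@hsubmxK _ n 1 m M) trace_row_mx.
Qed.

(** The integrand times the standard density is sqrt 2 times the normal density of variance 2. *)
Lemma integral_normal_expR_sqr :
  \int[gam]_x (expR (x ^+ 2 / 4))%:E = (Num.sqrt 2)%:E.
Proof.
rewrite ge0_integral_normal//; last first.
  apply/measurable_EFinP/measurableT_comp => //.
  by apply: measurable_funM => //; exact: measurable_funX.
have s2 : Num.sqrt 2 != 0%R :> R by rewrite sqrtr_eq0 -ltNge.
have s22 : (Num.sqrt 2 ^+ 2 = 2 :> R)%R by rewrite sqr_sqrtr.
apply: (@etrans _ _ (\int[lebesgue_measure]_x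
  ((Num.sqrt 2)%:E * (normal_pdf 0 (Num.sqrt 2) x)%:E))).
  apply: eq_integral => x _; rewrite -!EFinM; congr EFin.
  rewrite !normal_pdfE ?oner_eq0//= /normal_fun mulrCA -expRD mulrA.
  congr (_ * expR _)%R; last by rewrite s22 !subr0 expr1n; field.
  rewrite /normal_peak s22 expr1n mul1r -[(2 * pi *+ 2)%R]mulrnAr sqrtrM//.
  by rewrite invfM mulrA divff// mul1r.
rewrite ge0_integralZl ?lee_fin ?sqrtr_ge0//.
- by rewrite integral_normal_pdf mule1.
- by apply/measurable_EFinP; exact: measurable_normal_pdf.
- by move=> x _; rewrite lee_fin normal_pdf_ge0.
Qed.

Lemma measurable_expR_sqr k : measurable_fun setT
  (fun a : vec R k => (expR ((\sum_i tnth a i ^+ 2) / 4))%:E).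
Proof.
apply/measurable_EFinP/measurableT_comp => //.
apply: measurable_funM => //; apply: measurable_sum => i.
by apply: measurable_funX; exact: measurable_tnth.
Qed.

Lemma gaussv_expR_sqr k :
  \int[gaussv R k]_a (expR ((\sum_i tnth a i ^+ 2) / 4))%:E =
  (Num.sqrt 2 ^+ k)%:E.
Proof.
have msq := measurable_expR_sqr.
elim: k => [|k IH].
  by rewrite power_measure0E// big_ord0 mul0r expR0.
apply: etrans (power_measureSE _ (msq k.+1) _) _ => //.
apply: (@etrans _ _ (\int[gam]_x
  ((expR (x ^+ 2 / 4))%:E * (Num.sqrt 2 ^+ k)%:E))).
  apply: eq_integral => x _; rewrite -IH -ge0_integralZl//; last exact: msq.
  apply: eq_integral => t _; rewrite big_ord_recl tnth0 mulrDl expRD EFinM.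
  by under eq_bigr do rewrite tnthS.
have msq1 : measurable_fun setT (fun x : RR => (expR (x ^+ 2 / 4))%:E).
  apply/measurable_EFinP/measurableT_comp => //.
  by apply: measurable_funM => //; exact: measurable_funX.
apply: etrans (ge0_integralZr gam measurableT msq1 _ _) _ => //.
by rewrite integral_normal_expR_sqr -EFinM exprS.
Qed.

Lemma measurable_expR_trace m : measurable_fun setT
  (fun t : m.-tuple (vec R n) =>
     (expR (\tr ((mx_of t)^T *m mx_of t) / 4))%:E).
Proof.
apply/measurable_EFinP/measurableT_comp => //; apply: measurable_funM => //.
rewrite (_ : (fun _ => _) =
    fun t => (\sum_j \sum_i mx_of t i j * mx_of t i j)%R); last first.
  apply/funext => t; apply: eq_bigr => j _; rewrite mxE.
  by apply: eq_bigr => i _; rewrite !mxE.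
apply: measurable_sum => j; apply: measurable_sum => i.
by apply: measurable_funM; exact: measurable_mx_of.
Qed.

(** Serves the Chernoff bound on the Frobenius norm; the exponential factors over the columns. *)
Lemma gaussm_expR_trace m :
  Emx (fun A : 'M[R]_(n, m) => (expR (\tr (A^T *m A) / 4))%:E) =
  (Num.sqrt 2 ^+ (n * m))%:E.
Proof.
elim: m => [|m IH].
  rewrite muln0 expr0; apply: etrans (integral_probability_cst (gaussm R n 0) 1).
  by apply: eq_integral => t _; rewrite /mxtrace big_ord0 mul0r expR0.
have mF : mx_measurable
    (fun A : 'M[R]_(n, 1 + m) => (expR (\tr (A^T *m A) / 4))%:E).
  exact: measurable_expR_trace.
apply: etrans (EmxS mF _) _; first by move=> A; rewrite lee_fin expR_ge0.
apply: (@etrans _ _ (\int[gaussv R n]_a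
  ((expR ((\sum_i tnth a i ^+ 2) / 4))%:E * (Num.sqrt 2 ^+ (n * m))%:E))).
  apply: eq_integral => a _; rewrite -IH -ge0_integralZl//; last first.
    exact: measurable_expR_trace.
  apply: eq_integral => t _; rewrite trace_row_mx mulrDl expRD EFinM.
  have -> // : (\tr ((col_of a)^T *m col_of a) = \sum_i tnth a i ^+ 2)%R.
  by rewrite trace_mx11 mxE; apply: eq_bigr => i _; rewrite !mxE expr2.
rewrite ge0_integralZr//; last exact: measurable_expR_sqr.
by rewrite gaussv_expR_sqr -EFinM -exprD mulnS.
Qed.

End gaussian_matrix_laws.

(** * Adaptive queries *)

Section queries.
Variables (R : realType) (n : nat).
Implicit Types m k : nat.

(* On the inputs in [D], [f] is the output of a deterministic adaptive
   algorithm making [k] queries. *)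
Fixpoint query_computable k m (D : set 'M[R]_(n, m)) (f : 'M[R]_(n, m) -> R) :
    Prop :=
  if k is k'.+1 then
    exists x : 'cV[R]_m, forall b : 'cV[R]_n,
      query_computable k' (fun A => D A /\ A *m x = b) f
  else exists t, forall A, D A -> f A = t.

Lemma query_computable_sub k m (D D' : set 'M[R]_(n, m)) f :
  (forall A, D' A -> D A) ->
  query_computable k D f -> query_computable k D' f.
Proof.
elim: k D D' => [|k IH] D D' sub.
  by case=> t ft; exists t => A /sub; exact: ft.
case=> x fx; exists x => b; apply: IH (fx b) => A [/sub ? ?]; by split.
Qed.

(** A query [x] to B + A P is simulated by the query P x to A, whose answer is shifted by the known
    B x. *)
Lemma query_computable_affine k m m' (D : set 'M[R]_(n, m)) f
    (B : 'M[R]_(n, m)) (P : 'M[R]_(m', m)) (c : R) :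
  query_computable k D f ->
  query_computable k (fun A => D (B + A *m P)) (fun A => f (B + A *m P) - c).
Proof.
elim: k D => [|k IH] D.
  by case=> t ft; exists (t - c) => A /ft ->.
case=> x fx; exists (P *m x) => b.
apply: query_computable_sub (IH _ (fx (B *m x + b))) => A [DA Ab].
by split=> //; rewrite mulmxDl -mulmxA Ab.
Qed.

(** With the seed fixed, the next query is constant on the set of matrices that share a history [h]
    of answers. *)
Lemma query_computable_estimate (d : measure_display) (T : measurableType d)
    k (alg : query_algorithm R T n k) (w : T) :
  query_computable k (fun=> True) (fun A => estimate alg A w).
Proof.
suff H i j (h : j.-tuple (vec R n)) : (i + j = k)%N ->
    query_computable i (fun A => answers alg A w j = h)
      (fun A => estimate alg A w).
  apply: query_computable_sub (H k 0%N [tuple] (addn0 k)) => A _.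
  exact: tuple0.
elim: i j h => [|i IH] j h ijk.
  have {}ijk : j = k by [].
  by subst j; exists (output alg (w, h)) => A; rewrite /estimate => ->.
exists (\col_i0 tnth (query alg (w, h)) i0) => b.
pose b' : vec R n := [tuple b i0 0 | i0 < n].
apply: query_computable_sub (IH j.+1 [tuple of b' :: h] _); last by rewrite addnS.
move=> A [Ah Ab] /=; rewrite Ah.
have -> // : mulmxv A (query alg (w, h)) = b'.
by apply: eq_from_tnth => i0; rewrite !tnth_mktuple Ab.
Qed.

Local Open Scope ereal_scope.
Local Notation RR := (measurableTypeR R).
Local Notation gam := (normal_prob 0 1 : probability RR R).

(** Induction on [k]: a rotation turns the first query into a multiple of the first basis vector,
    and fixing the first column leaves one column and one query fewer. Rotations turn the trace into
    the inner product with [M], so orthonormal columns are the invariant; with no query left, [f] is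
    constant and the form has variance [m]. *)
Lemma query_lower_bound k m (M : 'M[R]_(n, k + m)) (f : 'M[R]_(n, k + m) -> R)
    (h : RR -> \bar R) (p : \bar R) :
  (M^T *m M = 1%:M)%R ->
  mx_measurable (fun A => (f A)%:E) -> query_computable k (fun=> True) f ->
  measurable_fun setT h -> (forall x, 0 <= h x) -> 0 <= p ->
  (forall t rho : R, (rho ^+ 2 = m%:R)%R -> \int[gam]_z h (t - rho * z)%R <= p) ->
  Emx (fun A => h (f A - \tr (M^T *m A))%R) <= p.
Proof.
move=> MM mf qf mh h0 p0 Hp; elim: k M f MM mf qf => [|k IH] M f MM mf qf.
  case: qf => t ft.
  have [rho rho2 Hrho] := gaussm_linear M.
  have mh' : measurable_fun setT (fun y : RR => h (t - y)%R).
    by apply: (measurableT_comp mh); exact: measurable_funB.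
  have -> : Emx (fun A => h (f A - \tr (M^T *m A))%R) =
            Emx (fun A => h (t - \tr (M^T *m A))%R).
    by apply: eq_integral => s _; rewrite ft.
  rewrite (Hrho _ mh' (fun y => h0 _)); apply: Hp.
  by rewrite rho2 MM mxtrace1.
case: qf => x qx.
have [Q [QQ [r Qx] iQ]] := exists_rotation n (x : 'cV[R]_(1 + (k + m))).
pose F (A : 'M[R]_(n, 1 + (k + m))) := h (f A - \tr (M^T *m A))%R.
have F0 A : 0 <= F A by exact: h0.
have mF : mx_measurable F.
  apply: (measurableT_comp mh); apply: measurable_funB.
    exact/measurable_EFinP.
  exact: measurable_trace_mul.
have mG := mx_measurable_mulr (Q^T)%R mF.
(* Invariance under [Q], applied to the function already composed with Q^T. *)
have -> : Emx F = Emx (fun A => F (A *m Q^T)%R).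
  rewrite -(iQ _ mG (fun A => F0 _)); apply: eq_integral => t _.
  by rewrite -mulmxA (mulmx1C QQ) mulmx1.
rewrite (EmxS mG (fun A => F0 _)).
apply: (@le_trans _ _ (\int[gaussv R n]_a p)); last first.
  by rewrite integral_probability_cst.
apply: ge0_le_integral => //.
- by move=> a _; apply: integral_ge0 => t _; exact: F0.
- exact: (measurable_Emx_row_mx mG (fun A => F0 _)).
move=> a _.
pose MQ : 'M[R]_(n, 1 + (k + m)) := (M *m Q)%R.
have MQE : (MQ^T *m MQ = 1%:M)%R.
  by rewrite /MQ trmx_mul mulmxA -(mulmxA _ M^T) MM mulmx1.
(* With the first column [a] fixed, [c] is its known share of the linear form and [B] its known
   share of the input. *)
pose c := (\tr ((lsubmx MQ)^T *m col_of a))%R.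
pose B := (col_of a *m usubmx Q^T)%R.
pose f' (A : 'M[R]_(n, k + m)) := (f (B + A *m dsubmx Q^T) - c)%R.
have rowE (A : 'M[R]_(n, k + m)) :
    (row_mx (col_of a) A *m Q^T = B + A *m dsubmx Q^T)%R.
  by rewrite -{1}[(Q^T)%R](@vsubmxK _ 1 (k + m)) mul_row_col.
have FE A : F (row_mx (col_of a) A *m Q^T)%R =
    h (f' A - \tr ((rsubmx MQ)^T *m A))%R.
  rewrite /F rowE /f' -rowE; congr h; rewrite -addrA -opprD.
  congr (_ - _)%R; rewrite mulmxA mxtrace_mulC mulmxA.
  have -> : (Q^T *m M^T = MQ^T)%R by rewrite /MQ trmx_mul.
  by rewrite -{1}[MQ](@hsubmxK _ n 1 (k + m)) trace_row_mx.
have -> : Emx (fun A => F (row_mx (col_of a) A *m Q^T)%R) =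
    Emx (fun A => h (f' A - \tr ((rsubmx MQ)^T *m A))%R).
  by apply: eq_integral => t _; rewrite FE.
apply: IH.
- have : (row_mx (lsubmx MQ) (rsubmx MQ))^T *m
         (row_mx (lsubmx MQ) (rsubmx MQ)) = 1%:M :> 'M[R]_(1 + (k + m)).
    by rewrite hsubmxK.
  rewrite tr_row_mx mul_col_row scalar_mx_block => /eq_block_mx[_ _ _].
  exact.
- apply/measurable_EFinP/measurable_funB => //; apply/measurable_EFinP.
  have := mx_measurable_row_mx a (mx_measurable_mulr (Q^T)%R mf).
  rewrite /mx_measurable; under eq_fun do rewrite rowE.
  exact.
(* Every input with rotated first column [a] answers the first query by [r] times [a], so the
   remaining columns are unconstrained. *)
- apply: query_computable_sub (query_computable_affine B (dsubmx Q^T) c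
    (qx (r *: col_of a)%R)) => A _; split => //.
  rewrite -rowE -mulmxA Qx mul_row_col mulmx0 addr0.
  by rewrite mul_mx_scalar.
Qed.

End queries.

(** * Success probability on a Gaussian input *)

Section normal_bounds.
Variable R : realType.
Local Open Scope ereal_scope.
Local Notation RR := (measurableTypeR R).
Local Notation gam := (normal_prob 0 1 : probability RR R).
Local Notation leb := (@lebesgue_measure R).

Lemma normal_peak1_le : (normal_peak 1 <= 2^-1 :> R)%R.
Proof.
rewrite /normal_peak lef_pV2 ?posrE ?sqrtr_gt0//; last first.
  by rewrite expr1n mul1r mulrn_wgt0 ?pi_gt0.
rewrite -[leLHS]ger0_norm// -sqrtr_sqr ler_sqrt; last first.
  by rewrite expr1n mul1r mulrn_wge0 ?pi_ge0.
by rewrite expr1n mul1r -mulr_natr; have := pi_ge2 R; lra.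
Qed.

(** The 3 is 2 + 1: sqrt (2 pi) <= 3 <= e^2, and (v + 1)^2 / 2 <= v^2 + 1. *)
Lemma normal_pdf_ge (x v : R) : (`|x| <= v + 1)%R ->
  (expR (- v ^+ 2 - 3) <= normal_pdf 0 1 x)%R.
Proof.
move=> xv; have v1 : (0 <= v + 1)%R by apply: le_trans xv.
have x2 : (x ^+ 2 <= (v + 1) ^+ 2)%R.
  by rewrite -real_normK ?num_real// lerXn2r ?nnegrE.
rewrite normal_pdfE ?oner_eq0// /normal_fun subr0 expr1n.
have -> : (- v ^+ 2 - 3 = - 2 + (- v ^+ 2 - 1))%R by ring.
rewrite expRD; apply: ler_pM; rewrite ?expR_ge0//; last first.
  by rewrite ler_expR; have := sqr_ge0 (v - 1)%R; nra.
rewrite expRN /normal_peak lef_pV2 ?posrE ?expR_gt0 ?sqrtr_gt0//; last first.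
  by rewrite expr1n mul1r mulrn_wgt0 ?pi_gt0.
apply: (@le_trans _ _ 3%R); last by have := expR_ge1Dx (2 : R)%R; lra.
rewrite -[leRHS]ger0_norm// -sqrtr_sqr ler_sqrt ?sqr_ge0//.
by rewrite expr1n mul1r -mulr_natr; have := pihalf_lt2 R; lra.
Qed.

Lemma normal_prob_itv_le (a b : R) : (a <= b)%R ->
  gam `[a, b]%classic <= ((b - a) / 2)%:E.
Proof.
move=> ab; rewrite /normal_prob.
apply: (@le_trans _ _ (\int[leb]_(x in `[a, b]%classic) (2^-1)%:E)).
  apply: ge0_le_integral => //=.
  - by move=> x _; rewrite lee_fin normal_pdf_ge0.
  - apply/measurable_EFinP/measurable_funTS; exact: measurable_normal_pdf.
  - move=> x _; rewrite lee_fin (le_trans _ normal_peak1_le)//.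
    by apply: normal_pdf_ub; rewrite oner_eq0.
rewrite integral_cst//= lebesgue_measure_itv/= lte_fin.
case: ifPn => [_|]; first by rewrite -EFinB -EFinM mulrC.
by rewrite mule0 lee_fin divr_ge0 ?subr_ge0.
Qed.

Lemma normal_prob_itv_ge (a b v : R) : b = (a + 1)%R ->
  (`|a| <= v + 1)%R -> (`|b| <= v + 1)%R ->
  (expR (- v ^+ 2 - 3))%:E <= gam `]a, b[%classic.
Proof.
move=> bE av bv; rewrite /normal_prob.
apply: (@le_trans _ _ (\int[leb]_(x in `]a, b[%classic) (expR (- v ^+ 2 - 3))%:E)).
  rewrite integral_cst//= lebesgue_measure_itv/= lte_fin bE ltrDl ltr01.
  by rewrite -EFinB addrAC subrr add0r mule1.
apply: ge0_le_integral => //=.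
- apply/measurable_EFinP/measurable_funTS; exact: measurable_normal_pdf.
- move=> x; rewrite in_itv/= => /andP[ax xb]; rewrite lee_fin normal_pdf_ge//.
  move: av bv; rewrite !ler_norml => /andP[? ?] /andP[? ?].
  by apply/andP; split; lra.
Qed.

(** The density is at most 1/2 on a length 2 v. Moreover the interval misses []v, v + 1[] or []- v -
    1, - v[], according to the sign of [z]. *)
Lemma normal_prob_ball_le (z v : R) : (0 <= v)%R ->
  gam `[(z - v)%R, (z + v)%R]%classic <= v%:E /\
  gam `[(z - v)%R, (z + v)%R]%classic <= (1 - expR (- v ^+ 2 - 3))%:E.
Proof.
move=> v0; split.
  apply: le_trans (normal_prob_itv_le _) _; first by lra.
  by rewrite lee_fin; lra.
have disj (a b : R) : b = (a + 1)%R -> (`|a| <= v + 1)%R -> (`|b| <= v + 1)%R ->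
    (b <= z - v \/ z + v <= a)%R ->
    gam `[(z - v)%R, (z + v)%R]%classic <= (1 - expR (- v ^+ 2 - 3))%:E.
  move=> bE av bv zab.
  have mab : measurable (`]a, b[%classic : set RR) by exact: measurable_itv.
  apply: (@le_trans _ _ (gam (~` `]a, b[)%classic)).
    apply: le_measure; rewrite ?inE; [exact: measurable_itv|exact: measurableC|].
    by move=> x /=; rewrite !in_itv/= => /andP[? ?] /andP[? ?]; case: zab; lra.
  rewrite probability_setC// EFinB leeB//.
  exact: normal_prob_itv_ge.
have [z0|z0] := leP z 0%R.
- apply: (disj (v : R) (v + 1)%R); [by []| | |].
  + by rewrite ger0_norm; lra.
  + by rewrite ger0_norm; lra.
  + by right; lra.
- apply: (disj (- v - 1)%R (- v)%R); [by ring| | |by left; lra].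
  + by rewrite ler0_norm; lra.
  + by rewrite ler0_norm; lra.
Qed.

End normal_bounds.

(** * Joint measurability of the estimate in the seed and the input *)

Section estimate.
Variables (R : realType) (d : measure_display) (T : measurableType d).
Variables (n k : nat) (alg : query_algorithm R T n k).
Local Notation RR := (measurableTypeR R).

Lemma measurable_answers j : measurable_fun setT
  (fun z : T * n.-tuple (vec R n) => answers alg (mx_of z.2) z.1 j).
Proof.
elim: j => [|j IH]; first exact: measurable_cst.
apply: measurable_cons => //.
have mq : measurable_fun setT (fun z : T * n.-tuple (vec R n) =>
    query alg (z.1, answers alg (mx_of z.2) z.1 j)).
  apply: (measurableT_comp (measurable_query alg (j := j))).
  exact: measurable_fun_pair.
apply/measurable_fun_tnthP => i.
rewrite (_ : _ \o _ = fun z => \sum_l mx_of z.2 i l *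
    tnth (query alg (z.1, answers alg (mx_of z.2) z.1 j)) l); last first.
  by apply/funext => z /=; rewrite tnth_mktuple mxE; apply: eq_bigr => l _;
    rewrite [X in _ * X = _]mxE.
apply: measurable_sum => l; apply: measurable_funM.
  exact: (measurableT_comp (@measurable_mx_of R n n i l)).
exact: (measurableT_comp (@measurable_tnth _ RR n l) mq).
Qed.

Lemma measurable_estimate : measurable_fun setT
  (fun z : T * n.-tuple (vec R n) => estimate alg (mx_of z.2) z.1 : RR).
Proof.
apply: (measurableT_comp (measurable_output alg)).
by apply: measurable_fun_pair => //; exact: measurable_answers.
Qed.

Lemma estimate_noquery (A B : 'M[R]_n) (w : T) : k = 0%N ->
  estimate alg A w = estimate alg B w.
Proof.
by case: k alg => // alg' _.
Qed.

End estimate.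

(** * Averaging the guarantee over the Gaussian input *)

Section tradeoff.
Variables (R : realType) (d : measure_display) (T : measurableType d).
Variable P : probability T R.
Local Notation RR := (measurableTypeR R).
Local Notation gam := (normal_prob 0 1 : probability RR R).

Lemma measurable_dist_le (f : T -> RR) (c r : R) :
  measurable_fun setT f -> measurable [set w | `|f w - c| <= r].
Proof.
move=> mf; rewrite (_ : mkset _ = (f @^-1` `[c - r, c + r])%classic).
  by rewrite -[X in measurable X]setTI; apply: mf => //; exact: measurable_itv.
by apply/seteqP; split=> w /=; rewrite in_itv/= ler_distl.
Qed.

Definition window (tau y : R) : \bar R := (\1_(`[- tau, tau]%classic : set R) y)%:E.

Lemma windowE (tau y : R) : window tau y = (`|y| <= tau)%R%:R%:E.
Proof.
rewrite /window indicE.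
have -> // : (y \in (`[- tau, tau]%classic : set R)) = (`|y| <= tau).
by apply/idP/idP; rewrite inE /= in_itv/= ler_norml.
Qed.

Lemma measurable_window tau : measurable_fun setT (window tau : RR -> \bar R).
Proof. by apply/measurable_EFinP; exact: measurable_indic. Qed.

Lemma window_ge0 tau y : (0 <= window tau y)%E.
Proof. by rewrite lee_fin. Qed.

Lemma integral_window (tau v t rho : R) : rho != 0 -> tau = `|rho| * v ->
  (\int[gam]_z window tau (t - rho * z) =
   gam `[(t / rho - v)%R, (t / rho + v)%R]%classic)%E.
Proof.
move=> rho0 tauE; rewrite -[X in gam X]setIT -integral_indic//.
apply: eq_integral => z _; rewrite windowE indicE; congr ((nat_of_bool _)%:R%:E).
have -> : t - rho * z = rho * (t / rho - z) by field.
rewrite normrM tauE ler_pM2l ?normr_gt0// distrC.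
by apply/idP/idP; rewrite inE /= in_itv/= ler_distl.
Qed.

(** [tau] is the tolerance when the Frobenius norm is at most 3 n, and [v] is [tau] in units of sqrt
    m, the standard deviation of the unknown part of the trace. The success probability is
    integrated over seed and input in both orders. *)
Lemma estimator_tradeoff (p delta eps : R) (k m : nat)
    (alg : query_algorithm R T (k + m) k) (q v : R) :
  let n := (k + m)%N in
  1 <= p <= 2 -> 0 <= delta <= 1 -> 0 <= eps -> (0 < m)%N ->
  trace_estimator P p delta eps alg ->
  v = eps * n%:R `^ (p^-1 - 2^-1) * (3 * n%:R) / Num.sqrt m%:R ->
  0 <= q ->
  (forall z, gam `[(z - v)%R, (z + v)%R]%classic <= q%:E)%E ->
  (1 - delta) * (1 - expR (- n%:R ^+ 2)) <= q.
Proof.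
move=> n p12 /andP[d0 d1] eps0 m0 est vE q0 Hq.
set tau := eps * n%:R `^ (p^-1 - 2^-1) * (3 * n%:R) in vE.
have sm0 : 0 < Num.sqrt m%:R :> R by rewrite sqrtr_gt0 ltr0n.
have tau0 : 0 <= tau by rewrite !mulr_ge0// powR_ge0.
pose Phi (z : T * n.-tuple (vec R n)) :=
  window tau (estimate alg (mx_of z.2) z.1 - \tr (mx_of z.2)).
have Phi0 z : (0 <= Phi z)%E by exact: window_ge0.
have mtr : measurable_fun setT (fun t : n.-tuple (vec R n) => \tr (mx_of t) : RR).
  by apply: measurable_sum => i; exact: measurable_mx_of.
have mPhi : measurable_fun setT Phi.
  apply: (measurableT_comp (@measurable_window tau)); apply: measurable_funB.
    exact: measurable_estimate.
  exact: (measurableT_comp mtr).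
have mest t : measurable_fun setT (fun w => estimate alg (mx_of t) w : RR).
  have mpair : measurable_fun setT (fun w : T => (w, t)).
    exact: measurable_fun_pair.
  exact: (measurableT_comp (@measurable_estimate _ _ _ _ _ alg) mpair).
have upper : (\int[P]_w \int[gaussm R n n]_t Phi (w, t) <= q%:E)%E.
  apply: (@le_trans _ _ (\int[P]_w q%:E)%E); last first.
    by rewrite integral_probability_cst.
  apply: ge0_le_integral => //.
  - by move=> w _; exact: integral_ge0.
  - exact: measurable_integral_snd.
  move=> w _.
  have := @query_lower_bound R n k m 1%:M (fun A => estimate alg A w)
    (window tau) q%:E.
  have -> : Emx (fun A : 'M[R]_(n, k + m) =>
      window tau (estimate alg A w - \tr (1%:M^T *m A))) =
      (\int[gaussm R n n]_t Phi (w, t))%E.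
    by apply: eq_integral => t _; rewrite /Phi /= trmx1 mul1mx.
  apply.
  - by rewrite trmx1 mulmx1.
  - apply/measurable_EFinP.
    have mpair : measurable_fun setT (fun t : n.-tuple (vec R n) => (w, t)).
      exact: measurable_fun_pair.
    exact: (measurableT_comp (@measurable_estimate _ _ _ _ _ alg) mpair).
  - exact: query_computable_estimate.
  - exact: measurable_window.
  - exact: window_ge0.
  - by rewrite lee_fin.
  move=> t rho rho2.
  have rhoE : `|rho| = Num.sqrt m%:R by rewrite -rho2 sqrtr_sqr.
  have rho0 : rho != 0 by rewrite -normr_eq0 rhoE gt_eqF.
  rewrite (@integral_window tau v)//.
  by rewrite rhoE vE mulrC divfK// gt_eqF.
(* Chernoff's bound, pointwise: if the squared Frobenius norm is at most 8 n^2 <= (3 n)^2 the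
   guarantee applies within [tau]; otherwise the product of exponentials is at least 1. *)
have lower t : ((1 - delta)%:E <= \int[P]_w Phi (w, t) +
    (1 - delta)%:E * ((expR (- (2 * n%:R ^+ 2)))%:E *
      (expR (\tr ((mx_of t)^T *m mx_of t) / 4))%:E))%E.
  set A := mx_of t; set Fr := \tr (A^T *m A).
  have d1' : 0 <= 1 - delta by rewrite subr_ge0.
  have [le8|gt8] := leP Fr (8 * n%:R ^+ 2).
    apply: (@le_trans _ _ (\int[P]_w Phi (w, t))%E); last first.
      by rewrite leeDl// mule_ge0 ?mule_ge0 ?lee_fin ?expR_ge0.
    apply: le_trans (est A) _.
    have -> : (\int[P]_w Phi (w, t) =
        P [set w | (`|estimate alg A w - \tr A| <= tau)%R]%classic)%E.
      rewrite -[X in P X]setIT -integral_indic//; last first.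
        exact: (measurable_dist_le _ _ (mest t)).
      apply: eq_integral => w _; rewrite /Phi windowE indicE.
      congr ((nat_of_bool _)%:R%:E).
      by apply/idP/idP; rewrite inE.
    apply: le_measure; rewrite ?inE; [exact: (measurable_dist_le _ _ (mest t))..|].
    move=> w /= /le_trans; apply.
    rewrite /tau -[leRHS]mulrA ler_wpM2l//.
    apply: le_trans (schatten_le_frobenius A p12) _.
    rewrite ler_wpM2l ?powR_ge0// -/Fr.
    rewrite -[leRHS]ger0_norm ?mulr_ge0// -sqrtr_sqr ler_sqrt ?sqr_ge0//.
    by rewrite exprMn (le_trans le8)// ler_wpM2r ?sqr_ge0//; lra.
  apply: (@le_trans _ _ ((1 - delta)%:E * ((expR (- (2 * n%:R ^+ 2)))%:E *
      (expR (Fr / 4))%:E))%E); last by rewrite leeDr// integral_ge0.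
  rewrite -!EFinM lee_fin ler_peMr// -expRD -[leLHS]expR0 ler_expR.
  by lra.
have : ((1 - delta)%:E <= q%:E + (1 - delta)%:E * (expR (- n%:R ^+ 2))%:E)%E.
  have d1' : (0 <= (1 - delta)%:E)%E by rewrite lee_fin subr_ge0.
  pose X (t : n.-tuple (vec R n)) : \bar R := (\int[P]_w Phi (w, t))%E.
  have mX : measurable_fun setT X by exact: (measurable_fun_fubini_tonelli_G Phi).
  have X0 t : (0 <= X t)%E by exact: integral_ge0.
  pose Y (t : n.-tuple (vec R n)) := (expR (\tr ((mx_of t)^T *m mx_of t) / 4 : R))%:E.
  have mY : measurable_fun setT Y := @measurable_expR_trace R n n.
  have Y0 t : (0 <= Y t)%E by rewrite lee_fin expR_ge0.
  pose e : \bar R := (expR (- (2 * n%:R ^+ 2)))%:E.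
  have e0 : (0 <= e)%E by rewrite lee_fin expR_ge0.
  have meY : measurable_fun setT (fun t => e * Y t)%E by exact: measurable_funeM.
  have eY0 t : (0 <= e * Y t)%E by exact: mule_ge0.
  have mdY : measurable_fun setT (fun t => (1 - delta)%:E * (e * Y t))%E.
    exact: measurable_funeM.
  have dY0 t : (0 <= (1 - delta)%:E * (e * Y t))%E by exact: mule_ge0.
  apply: (@le_trans _ _ (\int[gaussm R n n]_t (1 - delta)%:E)%E).
    by rewrite integral_probability_cst.
  apply: (@le_trans _ _ (\int[gaussm R n n]_t
      (X t + (1 - delta)%:E * (e * Y t)))%E).
    apply: ge0_le_integral => //; first exact: emeasurable_funD.
    by move=> t _; exact: lower.
  rewrite ge0_integralD//; apply: leeD.
    apply: le_trans upper; rewrite le_eqVlt; apply/orP; left; apply/eqP.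
    exact: (esym (fubini_tonelli Phi mPhi Phi0)).
  rewrite ge0_integralZl// lee_wpmul2l// ge0_integralZl//.
  have -> : (\int[gaussm R n n]_t Y t = (Num.sqrt 2 ^+ (n * n))%:E)%E.
    exact: gaussm_expR_trace.
  rewrite -EFinM lee_fin.
  (* Since sqrt 2 <= e, the moment sqrt 2 ^ (n^2) uses up only half of the exponent 2 n^2. *)
  have -> : - n%:R ^+ 2 = - (2 * n%:R ^+ 2) + n%:R ^+ 2 :> R by ring.
  rewrite expRD ler_wpM2l ?expR_ge0//.
  have -> : n%:R ^+ 2 = (n * n)%:R * 1 :> R by rewrite natrM mulr1 expr2.
  rewrite expRM_natl; apply: lerXn2r; rewrite ?nnegrE ?expR_ge0//.
  apply: (@le_trans _ _ 2); last by have := expR_ge1Dx (1 : R); lra.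
  rewrite -[leRHS]ger0_norm// -sqrtr_sqr ler_sqrt ?sqr_ge0//.
  by rewrite expr2; lra.
rewrite -EFinM -EFinD lee_fin; lra.
Qed.

Lemma estimator_tradeoff_dim (p delta eps : R) (n k : nat)
    (alg : query_algorithm R T n k) (v : R) :
  1 <= p <= 2 -> 0 <= delta <= 1 -> 0 <= eps -> (k < n)%N ->
  trace_estimator P p delta eps alg ->
  v = eps * n%:R `^ (p^-1 - 2^-1) * (3 * n%:R) / Num.sqrt (n - k)%:R ->
  (1 - delta) * (1 - expR (- n%:R ^+ 2)) <= v /\
  (1 - delta) * (1 - expR (- n%:R ^+ 2)) <= 1 - expR (- v ^+ 2 - 3).
Proof.
move=> p12 d01 eps0 kn; have v0 : 0 <= eps * n%:R `^ (p^-1 - 2^-1) *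
    (3 * n%:R) / Num.sqrt (n - k)%:R.
  by rewrite divr_ge0// !mulr_ge0// powR_ge0.
have := subnKC (ltnW kn); have : (0 < n - k)%N by rewrite subn_gt0.
move: (n - k)%N v0 => m v0 m0 nE; move: v0 alg; rewrite -nE => v0 alg est vE.
rewrite -vE in v0; have [/= H1 H2] := (fun z => (normal_prob_ball_le z v0).1,
  fun z => (normal_prob_ball_le z v0).2).
split; first exact: estimator_tradeoff est vE v0 H1.
apply: estimator_tradeoff est vE _ H2 => //.
rewrite subr_ge0 -[leRHS]expR0 ler_expR.
by have := sqr_ge0 v; lra.
Qed.

End tradeoff.

(** * Algorithms without queries *)

Section noquery.
Variables (R : realType) (d : measure_display) (T : measurableType d).
Variable P : probability T R.

Lemma schatten_scalar_le (n : nat) (p s : R) : 1 <= p <= 2 -> 0 <= s ->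
  schatten_norm p (s%:M : 'M[R]_n) <= s * n%:R `^ p^-1.
Proof.
move=> p12 s0; apply: le_trans (schatten_le_frobenius _ p12) _.
rewrite tr_scalar_mx -scalar_mxM mxtrace_scalar -[(s * s) *+ n]mulr_natr -expr2.
rewrite sqrtrM ?sqr_ge0// sqrtr_sqr ger0_norm// mulrCA -powR12_sqrt// -powRD.
  by rewrite subrK.
rewrite subrK; apply/implyP => /eqP h.
by move: p12; rewrite -[p]invrK h invr0 ler10.
Qed.

(** Success on s I forces an output of at least (1 - rho) s n. Without queries the output does not
    see s, so all events [E j] have probability at least 1 - delta, yet they decrease to the empty
    set. *)
Lemma noquery_not_estimator (p delta eps rho : R) (n k : nat)
    (alg : query_algorithm R T n k) :
  1 <= p <= 2 -> delta < 1 -> 0 <= eps -> k = 0%N -> (0 < n)%N ->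
  rho < 1 -> eps * n%:R `^ p^-1 <= rho * n%:R ->
  ~ trace_estimator P p delta eps alg.
Proof.
move=> p12 d1 eps0 k0 n0 rho1 le_rho est.
pose Y w := estimate alg 0 w.
have mY : measurable_fun setT (Y : T -> measurableTypeR R).
  have mpair : measurable_fun setT
      (fun w : T =>
        (w, [tuple of nseq n [tuple of nseq n 0]] : n.-tuple (vec R n))).
    exact: measurable_fun_pair.
  have := measurableT_comp (@measurable_estimate _ _ _ _ _ alg) mpair.
  rewrite (_ : _ \o _ = Y)//; apply/funext => w.
  exact: estimate_noquery.
pose E (j : nat) : set T := (Y @^-1` `[j%:R, +oo[)%classic.
have mE j : measurable (E j).
  by rewrite -[X in measurable X]setTI; apply: mY => //; exact: measurable_itv.
have PE j : ((1 - delta)%:E <= P (E j))%E.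
  pose s : R := j%:R / ((1 - rho) * n%:R).
  have rn0 : 0 < (1 - rho) * n%:R by rewrite mulr_gt0 ?subr_gt0 ?ltr0n.
  have s0 : 0 <= s by rewrite divr_ge0// ltW.
  have sE : s * n%:R - s * (rho * n%:R) = j%:R.
    by rewrite -mulrBr -[X in _ * (X - _)]mul1r -mulrBl divfK// gt_eqF.
  apply: le_trans (est s%:M) _; apply: le_measure; rewrite ?inE//.
    rewrite (_ : mkset _ = [set w | `|Y w - \tr (s%:M : 'M[R]_n)| <=
       eps * schatten_norm p (s%:M : 'M[R]_n)]%classic).
      exact: measurable_dist_le.
    by apply/seteqP; split=> w; rewrite /= /Y (estimate_noquery alg 0 s%:M w k0).
  move=> w; rewrite /E /= (estimate_noquery alg s%:M 0 w k0) -/(Y w) in_itv/= andbT.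
  rewrite mxtrace_scalar -[s *+ n]mulr_natr ler_distl => /andP[lo _].
  rewrite -sE; apply: le_trans lo; rewrite lerB//.
  apply: (@le_trans _ _ (eps * (s * n%:R `^ p^-1))).
    by rewrite ler_wpM2l// schatten_scalar_le.
  by rewrite mulrCA ler_wpM2l.
have capE : (\bigcap_j E j = set0)%classic.
  apply/seteqP; split=> // w /(_ (Num.truncn (Y w)).+1 I).
  by rewrite /E /= in_itv/= andbT leNgt truncnS_gt.
have cvgE : (P \o E @ \oo --> P (\bigcap_j E j)%classic)%classic.
  apply: nonincreasing_cvg_mu => //.
  - by rewrite (le_lt_trans (probability_le1 P (mE _)))// ltry.
  - by rewrite capE.
  - move=> i j ij; apply/subsetPset => w; rewrite /E /= !in_itv/= !andbT.
    by apply: le_trans; rewrite ler_nat.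
have : ((1 - delta)%:E <= P (\bigcap_j E j)%classic)%E.
  rewrite -(cvg_lim _ cvgE)//; apply: lime_ge.
    by apply/cvg_ex; eexists; exact: cvgE.
  by near=> j; exact: PE.
by rewrite capE measure0 lee_fin leNgt subr_gt0 d1.
Unshelve. all: by end_near. Qed.

(** For p > 1 the quotient of n^(1/p) by n tends to 0; for p = 1 it is always 1, and [rho] must be
    [eps] itself. *)
Lemma exists_large_dim (p eps : R) : 1 <= p -> 0 < eps -> (p = 1 -> eps < 1) ->
  exists n : nat, exists rho : R,
    [/\ (0 < n)%N, rho < 1 & eps * n%:R `^ p^-1 <= rho * n%:R].
Proof.
move=> p1 eps0 H; have [pE|p1'] := eqVneq p 1.
  by exists 1%N, eps; split=> //; [exact: H|rewrite powR1 mulr1].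
have {}p1 : 1 < p by rewrite lt_neqAle eq_sym p1'.
have p0 : 0 < p by apply: lt_trans p1.
have a0 : 0 < 1 - p^-1 by rewrite subr_gt0 invf_lt1.
pose x := (2 * eps) `^ (1 - p^-1)^-1.
exists (Num.truncn x).+1, 2^-1; split=> //; first by lra.
set N : R := (Num.truncn x).+1%:R.
have N0 : 0 < N by rewrite ltr0n.
have xN : x <= N by rewrite ltW// truncnS_gt.
have NE : N = N `^ p^-1 * N `^ (1 - p^-1).
  by rewrite -powRD ?subrKC ?powRr1 ?ltW// (gt_eqF N0) implybT.
have le2 : 2 * eps <= N `^ (1 - p^-1).
  rewrite -[leLHS](_ : x `^ (1 - p^-1) = _).
    by apply: ge0_ler_powR; rewrite ?nnegrE ?powR_ge0// ltW.
  by rewrite /x -powRrM mulVf ?gt_eqF// powRr1// mulr_ge0// ltW.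
rewrite [in leRHS]NE; have := powR_ge0 N p^-1.
by move: (N `^ p^-1) (N `^ (1 - p^-1)) le2 => u w le2 u0; nra.
Qed.

End noquery.

(** * Choice of the parameters *)

Section parameters.
Variable R : realType.

(** The bound on [eps] says L^(1/p) < sqrt L / eps. It later makes the dimension large enough for
    exp (- n^2) <= delta. *)
Lemma ratio_ge (L eps p : R) : 1 <= p -> 0 < L ->
  0 < eps < L `^ (2^-1 - p^-1) -> L <= (Num.sqrt L / eps) `^ p.
Proof.
move=> p1 L0 /andP[e0 eL]; have p0 : 0 < p by apply: lt_le_trans p1.
have le1 : L `^ p^-1 <= Num.sqrt L / eps.
  rewrite ler_pdivlMr// -powR12_sqrt ?(ltW L0)//.
  apply: (@le_trans _ _ (L `^ p^-1 * L `^ (2^-1 - p^-1))).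
    by rewrite ler_wpM2l ?powR_ge0// ltW.
  by rewrite -powRD ?subrKC// (gt_eqF L0) implybT.
rewrite -[leLHS](_ : (L `^ p^-1) `^ p = _).
  apply: ge0_ler_powR => //; first exact: ltW.
    by rewrite nnegrE powR_ge0.
  by rewrite nnegrE divr_ge0 ?sqrtr_ge0// ltW.
by rewrite -powRrM mulVf ?gt_eqF// powRr1// ltW.
Qed.

(** As m >= N / 2, the square is at most 18 eps^2 N^(2/p); and N^(2/p) <= c1 L / eps^2, because 2/p
    >= 1 and c1 <= 1. *)
Lemma window_width_le (L eps p c1 N m : R) : 1 <= p <= 2 -> 0 < L -> 0 < eps ->
  0 < c1 <= 1 -> 0 < N <= c1 * (Num.sqrt L / eps) `^ p -> N / 2 <= m ->
  (eps * N `^ (p^-1 - 2^-1) * (3 * N) / Num.sqrt m) ^+ 2 <= 18 * c1 * L.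
Proof.
move=> /andP[p1 p2] L0 e0 /andP[c0 c1le] /andP[N0 NX] Nm.
have p0 : 0 < p by apply: lt_le_trans p1.
have m0 : 0 < m by lra.
set y := N `^ (p^-1 - 2^-1).
have yE : y ^+ 2 * N = N `^ (2 / p).
  rewrite /y -powR_mulrn ?powR_ge0// -powRrM -{2}[N]powRr1 ?ltW// -powRD.
    by congr (_ `^ _); field; rewrite gt_eqF.
  by rewrite (gt_eqF N0) implybT.
have sL0 : 0 < Num.sqrt L / eps by rewrite divr_gt0 ?sqrtr_gt0.
have NL : N `^ (2 / p) <= c1 * (L / eps ^+ 2).
  have q0 : 0 <= 2 / p by rewrite divr_ge0// ltW.
  apply: (@le_trans _ _ ((c1 * (Num.sqrt L / eps) `^ p) `^ (2 / p))).
    apply: ge0_ler_powR => //; rewrite nnegrE; first exact: ltW.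
    by rewrite mulr_ge0 ?powR_ge0// ltW.
  rewrite powRM ?powR_ge0 ?(ltW c0)//; apply: ler_pM; rewrite ?powR_ge0//.
    apply: ge1r_powR; first by rewrite c0.
    by rewrite ler_pdivlMr// mul1r.
  rewrite -powRrM mulrCA divff ?gt_eqF// mulr1 powR_mulrn ?(ltW sL0)//.
  by rewrite exprMn exprVn sqr_sqrtr// (ltW L0).
rewrite !exprMn exprVn sqr_sqrtr ?(ltW m0)// ler_pdivrMr//.
apply: (@le_trans _ _ (18 * c1 * L * (N / 2))); last first.
  by rewrite ler_wpM2l// !mulr_ge0// ltW.
have -> : eps ^+ 2 * y ^+ 2 * (3 ^+ 2 * N ^+ 2) =
  9 * N * (eps ^+ 2 * (y ^+ 2 * N)) by ring.
have -> : 18 * c1 * L * (N / 2) = 9 * N * (eps ^+ 2 * (c1 * (L / eps ^+ 2))).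
  by field; rewrite gt_eqF.
rewrite yE ler_wpM2l ?mulr_ge0 ?(ltW N0)//.
by rewrite ler_wpM2l ?sqr_ge0.
Qed.

(** For ln (1/delta) >= 20 the second bound gives exp (- v^2 - 3) <= 2 delta, too small for such a
    [v]. Below 20, v <= (5/11) (1 - delta0), whereas the first bound gives v >= (1 - delta) / 2. *)
Lemma success_contradiction (delta delta0 v N : R) :
  0 < delta <= delta0 -> delta0 < 1 -> 1 <= N -> 0 <= v ->
  ln delta^-1 <= N ^+ 2 ->
  v ^+ 2 <= ((1 - delta0) / 11) ^+ 2 * ln delta^-1 ->
  (1 - delta) * (1 - expR (- N ^+ 2)) <= v ->
  (1 - delta) * (1 - expR (- N ^+ 2)) <= 1 - expR (- v ^+ 2 - 3) -> False.
Proof.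
move=> /andP[d0 dd] d1 N1 v0; set L := ln delta^-1 => LN vL b1 b2.
have dE : delta = expR (- L) by rewrite /L lnV ?posrE// opprK lnK ?posrE.
have N21 : 1 <= N ^+ 2 by rewrite expr_ge1//; lra.
have L0 : 0 < L by rewrite ln_gt0// invf_gt1//; lra.
have th1 : ((1 - delta0) / 11) ^+ 2 <= 1 / 121 by nra.
have [L20|L20] := leP 20 L.
  have tail : expR (- N ^+ 2) <= delta by rewrite dE ler_expR lerN2.
  have lo : expR (- v ^+ 2 - 3) <= 2 * delta by have := expR_ge0 (- N ^+ 2); nra.
  have e2 : 2 <= expR 1 :> R by have := expR_ge1Dx (1 : R); lra.
  have : 2 * delta < expR (- v ^+ 2 - 3).
    apply: (@le_lt_trans _ _ (expR (1 - L))).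
      by rewrite expRD -dE ler_wpM2r// ltW.
    by rewrite ltr_expR; nra.
  lra.
have tail : expR (- N ^+ 2) <= 2^-1.
  apply: (@le_trans _ _ (expR (- 1))); first by rewrite ler_expR lerN2.
  by rewrite expRN lef_pV2 ?posrE ?expR_gt0//; have := expR_ge1Dx (1 : R); lra.
have v5 : v <= (1 - delta0) / 11 * 5.
  rewrite -(@ler_pXn2r _ 2%N)// ?nnegrE//; last by lra.
  by rewrite exprMn; nra.
nra.
Qed.

End parameters.

(** [c] depends on [delta0] alone. For p = 1 and eps >= 1 the constant output 0 would succeed, since
    |tr A| is at most the nuclear norm. *)
Theorem theorem4p2 (R : realType) (delta0 : R)
    (hdelta0 : 0 < delta0 < 1) :
  exists2 c : R, 0 < c &
    forall (p delta eps : R),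
      1 <= p <= 2 ->
      0 < delta <= delta0 ->
      0 < eps < (ln delta^-1) `^ (2^-1 - p^-1) ->
      (p = 1 -> eps < 1) ->
    forall (d : measure_display) (T : measurableType d) (P : probability T R)
      (k : nat -> nat) (alg : forall n : nat, query_algorithm R T n (k n)),
      (forall n : nat, (0 < n)%N -> trace_estimator P p delta eps (alg n)) ->
      exists2 n : nat, (0 < n)%N &
        c * (Num.sqrt (ln delta^-1) / eps) `^ p <= (k n)%:R.
Proof.
have /andP[d00 d01] := hdelta0.
(* Matches the factor 18 of [window_width_le] to the bound required in [success_contradiction]. *)
pose c1 : R := ((1 - delta0) / 11) ^+ 2 / 18.
have c10 : 0 < c1 by rewrite divr_gt0// exprn_gt0// divr_gt0// subr_gt0.
have c1E : 18 * c1 = ((1 - delta0) / 11) ^+ 2 by rewrite /c1; field.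
have c11 : c1 <= 1 by nra.
(* If c1^2 X < 4, fewer than c1^2 X / 4 queries means none; otherwise it means at most N / 2, where
   N is c1 X rounded down. *)
exists (c1 ^+ 2 / 4); first by rewrite divr_gt0// exprn_gt0.
move=> p delta eps p12 dd heps p_eq1 d T P k alg est.
have /andP[d0 dle] := dd; have /andP[e0 _] := heps; have /andP[p1 p2] := p12.
set L := ln delta^-1 in heps *; set X := (Num.sqrt L / eps) `^ p.
have L0 : 0 < L by rewrite ln_gt0// invf_gt1//; lra.
have LX : L <= X by apply: ratio_ge.
apply: contrapT => no.
have kX n : (0 < n)%N -> (k n)%:R < c1 ^+ 2 / 4 * X.
  by move=> n0; rewrite ltNge; apply/negP => h; apply: no; exists n.
have [Xbig|Xsmall] := leP 4 (c1 * (c1 * X)); last first.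
  have [n [rho [n0 rho1 le_rho]]] := exists_large_dim p1 e0 p_eq1.
  have kn0 : k n = 0%N.
    have := kX n n0; have -> : c1 ^+ 2 / 4 * X = c1 * (c1 * X) / 4 by field.
    move=> h; have : (k n)%:R < 1 :> R by lra.
    by rewrite (ltr_nat R _ 1) ltnS leqn0 => /eqP.
  apply: (noquery_not_estimator p12 _ (ltW e0) kn0 n0 rho1 le_rho (est n n0)).
  exact: le_lt_trans d01.
pose n := Num.truncn (c1 * X); pose N : R := n%:R.
have c1X4 : 4 <= c1 * X by nra.
have NX : N <= c1 * X by rewrite truncn_le//; lra.
have XN : c1 * X < N + 1 by rewrite /N natr1 truncnS_gt.
have N0 : 0 < N by lra.
have n0 : (0 < n)%N by rewrite -(ltr0n R).
have kN : (k n)%:R <= N / 2 by have := kX n n0; nra.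
have kn : (k n < n)%N by rewrite -(ltr_nat R) -/N; lra.
have mN : N / 2 <= (n - k n)%:R by rewrite natrB ?(ltnW kn)// -/N; lra.
have d01' : 0 <= delta <= 1 by rewrite ltW//=; lra.
have [b1 b2] := estimator_tradeoff_dim p12 d01' (ltW e0) kn (est n n0) erefl.
apply: (success_contradiction dd d01 _ _ _ _ b1 b2).
- by rewrite ler1n.
- by rewrite divr_ge0// !mulr_ge0 ?powR_ge0// ltW.
(* From c1 X >= 4 and c1^2 X >= 4: N^2 >= (9/16) c1^2 X^2 >= X >= L. *)
- by apply: (le_trans LX); rewrite -/N; nra.
- rewrite -/N -c1E; apply: window_width_le => //.
    by rewrite c10.
  by rewrite N0.
Qed.
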